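(* Let $(t,x)\in\mathbb{R}_+\times D$ and $p,q\in\mathbb{R}$ such that $p+1,\,q\in U_{t,x}$. For $k\in\mathbb{R}$ let $$a_{t,x}(k)=\mathbb{E}_x\big[e^{-R_t}S_t1_{\{\log S_t>k\}}\big],\quad b_{t,x}(k)=\mathbb{E}_x\big[e^{-R_t}1_{\{\log S_t>k\}}\big],\quad c_{t,x}(k)=\mathbb{E}_x\big[e^{-R_t}(S_t-e^k)^+\big].$$ Then $$a_{t,x}(k)=R_a(p)+\frac{e^{-pk}}{\pi}\int_0^\infty\operatorname{Re}\big(e^{-iyk}g_a(y)\big)dy,$$ $$b_{t,x}(k)=R_b(q)+\frac{e^{-qk}}{\pi}\int_0^\infty\operatorname{Re}\big(e^{-iyk}g_b(y)\big)dy,$$ $$c_{t,x}(k)=R_c(p)+\frac{e^{-pk}}{\pi}\int_0^\infty\operatorname{Re}\big(e^{-iyk}g_c(y)\big)dy,$$ where $$g_a(y)=\frac{h_{t,x}(p+1+iy)}{p+iy},\quad g_b(y)=\frac{h_{t,x}(q+iy)}{q+iy},\quad g_c(y)=\frac{h_{t,x}(p+1+iy)}{p^2+p-y^2+iy(2p+1)},$$ $$R_a(p)=\begin{cases}h_{t,x}(1)&\text{if }p<0\\ \tfrac12h_{t,x}(1)&\text{if }p=0\\0&\text{if }p>0\end{cases},\qquad R_b(q)=\begin{cases}h_{t,x}(0)&\text{if }q<0\\ \tfrac12h_{t,x}(0)&\text{if }q=0\\0&\text{if }q>0\end{cases},$$ $$R_c(p)=\begin{cases}h_{t,x}(1)-e^kh_{t,x}(0)&\text{if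 }p<-1\\ h_{t,x}(1)-\tfrac12e^kh_{t,x}(0)&\text{if }p=-1\\ h_{t,x}(1)&\text{if }-1<p<0\\ \tfrac12h_{t,x}(1)&\text{if }p=0\\0&\text{if }p>0\end{cases}.$$
   Context: **The affine process.** Let $D=\mathbb{R}_+^m\times\mathbb{R}^{n-m}$ with $n\ge 1$, $0\le m\le n$; $\mathcal{I}=\{1,\dots,m\}$, $\mathcal{J}=\{m+1,\dots,n\}$; subscripts $\mathcal{I},\mathcal{J}$ on vectors and matrices denote the corresponding components/blocks. $\langle x,y\rangle=\sum_i x_iy_i$ (non-Hermitian, also on $\mathbb{C}^n$). $(X_t,\mathbb{P}_x)_{t\ge0,x\in D}$ is a time-homogeneous $D$-valued Markov process with RCLL paths, $X_0=x$ under $\mathbb{P}_x$, $\mathbb{E}_x$ the expectation under $\mathbb{P}_x$, such that: (H1) $X_t\to X_{t_0}$ in $\mathbb{P}_x$-probability as $t\to t_0$, for all $x\in D$; (H2) there are functions $\phi:\mathbb{R}_+\times i\mathbb{R}^n\to\mathbb{C}$, $\psi:\mathbb{R}_+\times i\mathbb{R}^n\to\mathbb{C}^n$ with $\mathbb{E}_x[\exp(\langle u,X_t\rangle)]=\exp(\phi(t,u)+\langle\psi(t,u),x\rangle)$ for all $x\in D$, $(t,u)\in\mathbb{R}_+\times i\mathbb{R}^n$. Such a process is Feller, and its generator $\mathcal{A}$ has $C_c^2(D)$ as a core and acts on $f\in C^2_c(D)$ by $$\mathcal{A}f(x)=\sum_{k,l=1}^n\Big(a_{kl}+\sum_{i\in\mathcal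 I}\alpha_{i,kl}x_i\Big)\frac{\partial^2f(x)}{\partial x_k\partial x_l}+\langle b+\beta x,\nabla f(x)\rangle+\int_{D\setminus\{0\}}\big(f(x+\xi)-f(x)-\langle\nabla_{\mathcal J}f(x),\chi_{\mathcal J}(\xi)\rangle\big)\nu(d\xi)$$ $$+\sum_{i=1}^m\int_{D\setminus\{0\}}\big(f(x+\xi)-f(x)-\langle\nabla_{\mathcal J\cup\{i\}}f(x),\chi_{\mathcal J\cup\{i\}}(\xi)\rangle\big)x_i\,\mu_i(d\xi),$$ where $\chi=(\chi_1,\dots,\chi_n)$, $\chi_k(\xi)=0$ if $\xi_k=0$ and $\chi_k(\xi)=(1\wedge|\xi_k|)\xi_k/|\xi_k|$ otherwise, and the parameters satisfy: (i) $a\in\mathbb{R}^{n\times n}$ symmetric positive semi-definite with $a_{\mathcal{II}}=0$; (ii) for $i\in\mathcal I$, $\alpha_i\in\mathbb{R}^{n\times n}$ symmetric positive semi-definite, all entries of $\alpha_{i,\mathcal{II}}$ being zero except for $\alpha_{i,ii}$; (iii) $b\in D$; (iv) $\beta\in\mathbb{R}^{n\times n}$ with $\beta_{\mathcal{IJ}}=0$ and $\beta_{\mathcal{II}}$ having non-negative off-diagonal elements; (v) $\nu$ is a Borel measure on $D\setminus\{0\}$ with $\int(\langle\chi_{\mathcal I}(\xi),\mathbf 1\rangle+\|\chi_{\mathcal J}(\xi)\|^2)\nu(d\xi)<\infty$; (vi) $\mu_i$, $i\in\mathcal I$, are Borel measures on $D\setminus\{0\}$ with $\int(\langle\chi_{\mathcal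 I\setminus\{i\}}(\xi),\mathbf 1\rangle+\|\chi_{\mathcal J\cup\{i\}}(\xi)\|^2)\mu_i(d\xi)<\infty$; (vii) for all $q\in\mathbb{R}^n$, $\int e^{\langle q,\xi\rangle}1_{\{\|\xi\|\ge1\}}\nu(d\xi)<\infty$ and $\int e^{\langle q,\xi\rangle}1_{\{\|\xi\|\ge1\}}\mu_i(d\xi)<\infty$ for all $i\in\mathcal I$. **The stock model.** Fix $(e,\varepsilon)\in\mathbb{R}\times\mathbb{R}^n$, $(d,\delta)\in\mathbb{R}_+\times\mathbb{R}_+^m$, $(c,\gamma)\in\mathbb{R}_+\times\mathbb{R}_+^m$. Set $s_t=e+\langle\varepsilon,X_t\rangle$, $R_t=\int_0^t(d+\langle\delta,X_{\mathcal I,u}\rangle)du$, $\Lambda_t=\int_0^t(c+\langle\gamma,X_{\mathcal I,u}\rangle)du$, $\tau=\inf\{t\ge0:\Lambda_t=E\}$ with $E$ a standard exponential random variable independent of $X$, and $S_t=\exp(s_t+R_t+\Lambda_t)1_{\{t<\tau\}}$ (with $\log0=-\infty$). **Discounted moments.** $U_{t,x}=\{z\in\mathbb{C}:\mathbb{E}_x[e^{-R_t}S_t^{\operatorname{Re}(z)}1_{\{t<\tau\}}]<\infty\}$, and $h_{t,x}(z)=\mathbb{E}_x[e^{-R_t}S_t^z1_{\{t<\tau\}}]$ for $z\in U_{t,x}$, where $S_t^z=\exp(z(s_t+R_t+\Lambda_t))$ on $\{t<\tau\}$; for real $z$ the same expectation is defined in $[0,\infty]$. **Conventions.** Integrals $\int_0^\infty$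 that are not absolutely convergent are understood as improper integrals $\lim_{N\to\infty}\int_0^N$.
   Formalization: The formulas for a(k) and b(k) are proved only when P_x(log S_t = k) = 0; at an atom of log S_t they fail (e.g. t = 0, p = q = 1, k = e + ⟨ε,x⟩). The formula for c(k) is proved for every k. When p or q is 0 (also p = -1 for c), the integral is also improper at y = 0. *)

(* Defs.v *)
From HB Require Import structures.
From mathcomp Require Import all_boot all_order all_algebra.
From mathcomp Require Import all_classical all_reals all_analysis.
From mathcomp Require Import measurable_realfun.
From mathcomp.real_closed Require Import complex.
Import Order.TTheory GRing.Theory Num.Theory.
Import numFieldNormedType.Exports.

Set Implicit Arguments.
Unset Strict Implicit.
Unset Printing Implicit Defensive.

Local Open Scope classical_set_scope.
Local Open Scope ring_scope.
Local Open Scope complex_scope.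

Definition cexp (R : realType) (z : R[i]) : R[i] :=
  (expR (complex.Re z) * cos (complex.Im z)) +i*
  (expR (complex.Re z) * sin (complex.Im z)).

Definition cexpectation (R : realType) (d : measure_display)
    (T : measurableType d) (P : probability T R) (f : T -> R[i]) : R[i] :=
  (\int[P]_(w in setT) complex.Re (f w)) +i*
  (\int[P]_(w in setT) complex.Im (f w)).

(* [improper_integral f l]: the integral of f over (0, oo) exists and equals l
   as lim_(N -> oo) int_0^N f.  The integral int_0^N is itself the limit of
   int_del^N as del -> 0+, because f may be undefined at 0; when f is integrable
   on [0, N] (resp. on [0, oo)) this is the Lebesgue integral. *)
Definition improper_integral (R : realType) (f : R -> R) (l : R) : Prop :=
  exists F : R -> R,
    [/\ forall del N : R, 0 < del ->
          (@lebesgue_measure R).-integrable `[del, N] (EFin \o f),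
        forall N : R, 0 < N ->
          (\int[@lebesgue_measure R]_(y in `[del, N]) f y)
            @[del --> 0^'+] --> F N
      & F N @[N --> +oo] --> l].

(* R^n with its Borel sigma-algebra. *)
Definition borel_rV (R : realType) (n : nat) :=
  g_sigma_algebraType (@open 'rV[R]_n).

Definition dot (R : realType) (n : nat) (x y : 'rV[R]_n) : R :=
  \sum_(k < n) x 0 k * y 0 k.

Definition enorm (R : realType) (n : nat) (x : 'rV[R]_n) : R :=
  Num.sqrt (dot x x).

(* The non-Hermitian product of a complex and a real vector. *)
Definition cdot (R : realType) (n : nat) (u : 'rV[R[i]]_n) (x : 'rV[R]_n)
    : R[i] :=
  \sum_(k < n) u 0 k * (x 0 k)%:C.

(* The state space R_+^m x R^(n-m); the index set I is {k | k < m}, J is its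
   complement. *)
Definition state_space (R : realType) (n m : nat) : set 'rV[R]_n :=
  [set x | forall k : 'I_n, (k < m)%N -> 0 <= x 0 k].
Arguments state_space R n m : clear implicits.

Definition state_space0 (R : realType) (n m : nat) : set 'rV[R]_n :=
  state_space R n m `\ 0.
Arguments state_space0 R n m : clear implicits.

Definition chi (R : realType) (n : nat) (xi : 'rV[R]_n) (k : 'I_n) : R :=
  if xi 0 k == 0 then 0 else Num.min 1 `|xi 0 k| * (xi 0 k / `|xi 0 k|).

Definition psd (R : realType) (n : nat) (A : 'M[R]_n) : Prop :=
  A^T = A /\ forall v : 'rV[R]_n, 0 <= (v *m A *m v^T) 0 0.

(* The jump measures live on D \ {0}: only their restriction to that set is ever
   used. *)
Record affine_param (R : realType) (n m : nat) := AffineParam {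
  ap_a : 'M[R]_n;
  ap_alpha : 'I_m -> 'M[R]_n;
  ap_b : 'rV[R]_n;
  ap_beta : 'M[R]_n;
  ap_nu : {measure set (borel_rV R n) -> \bar R};
  ap_mu : 'I_m -> {measure set (borel_rV R n) -> \bar R} }.

Section Affine.
Context (R : realType) (n m : nat) (hmn : (m <= n)%N).
Implicit Types (A : affine_param R n m) (f g : 'rV[R]_n -> R) (x : 'rV[R]_n).

Local Notation D := (state_space R n m).
Local Notation D0 := (state_space0 R n m).
Local Notation "'inI' i" := (widen_ord hmn i) (at level 10).

Record admissible (A : affine_param R n m) : Prop := Admissible {
  adm_a : psd (ap_a A) /\
    forall k l : 'I_n, (k < m)%N -> (l < m)%N -> ap_a A k l = 0;
  adm_alpha : forall i : 'I_m, psd (ap_alpha A i) /\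
    forall k l : 'I_n, (k < m)%N -> (l < m)%N ->
      ~ (k = inI i /\ l = inI i) -> ap_alpha A i k l = 0;
  adm_b : D (ap_b A);
  adm_betaIJ : forall k l : 'I_n, (k < m)%N -> (m <= l)%N ->
    ap_beta A k l = 0;
  adm_betaII : forall k l : 'I_n, (k < m)%N -> (l < m)%N -> k <> l ->
    0 <= ap_beta A k l;
  adm_nu : (\int[ap_nu A]_(xi in D0)
    (\sum_(k < n | (k < m)%N) chi xi k
     + \sum_(k < n | (m <= k)%N) chi xi k ^+ 2)%:E < +oo)%E;
  adm_mu : forall i : 'I_m, (\int[ap_mu A i]_(xi in D0)
    (\sum_(k < n | (k < m)%N && (k != inI i)) chi xi k
     + \sum_(k < n | (m <= k)%N || (k == inI i)) chi xi k ^+ 2)%:E < +oo)%E;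
  adm_nu_exp : forall q : 'rV[R]_n, (\int[ap_nu A]_(xi in D0)
    (expR (dot q xi) * (1 <= enorm xi)%R%:R)%:E < +oo)%E;
  adm_mu_exp : forall (i : 'I_m) (q : 'rV[R]_n), (\int[ap_mu A i]_(xi in D0)
    (expR (dot q xi) * (1 <= enorm xi)%R%:R)%:E < +oo)%E }.

Definition partial (k : 'I_n) f : 'rV[R]_n -> R :=
  fun x => 'D_(delta_mx 0 k) f x.

(* C_c^2(D) is the set of restrictions to D of the functions in C_c^2(R^n). *)
Definition C2c f : Prop :=
  [/\ forall k x, derivable f x (delta_mx 0 k),
      forall k, continuous (partial k f),
      forall k l x, derivable (partial k f) x (delta_mx 0 l),
      forall k l, continuous (partial l (partial k f))
    & compact (closure [set x | f x != 0])].

Definition jump_integral (nu : {measure set (borel_rV R n) -> \bar R})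
    (K : pred 'I_n) f x : R :=
  \int[nu]_(xi in D0)
    (f (x + (xi : 'rV[R]_n)) - f x - \sum_(k < n | K k) partial k f x * chi xi k).

Definition affine_generator A f x : R :=
  \sum_(k < n) \sum_(l < n)
     (ap_a A k l + \sum_(i < m) ap_alpha A i k l * x 0 (inI i))
     * partial l (partial k f) x
  + \sum_(k < n)
     (ap_b A 0 k + \sum_(l < n) ap_beta A k l * x 0 l) * partial k f x
  + jump_integral (ap_nu A) (fun k => (m <= k)%N) f x
  + \sum_(i < m)
     jump_integral (ap_mu A i) (fun k => (m <= k)%N || (k == inI i)) f x
     * x 0 (inI i).

(* C_0(D): only the values on D matter. *)
Definition C0 f : Prop :=
  {within D, continuous f} /\
  forall eps : R, 0 < eps ->
    exists M : R, forall x, D x -> M < `|x| -> `|f x| < eps.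

Section Process.
Context (d : measure_display) (T : measurableType d).
Context (P : 'rV[R]_n -> probability T R) (X : R -> T -> 'rV[R]_n).

(* The sigma-algebra generated by the X_u, u in U. *)
Definition sigma_X (U : set R) : set (set T) :=
  <<s [set H | exists (u : R) (B : set (borel_rV R n)),
        [/\ U u, measurable B & H = X u @^-1` B]] >>.

Definition markov_process : Prop :=
  [/\ forall t : R, 0 <= t -> @measurable_fun _ _ T (borel_rV R n) setT (X t),
      forall (t : R) w, 0 <= t -> D (X t w),
      forall x, D x -> P x [set w | X 0 w = x] = 1%E,
      forall (t : R) (B : set (borel_rV R n)), 0 <= t -> measurable B ->
        @measurable_fun _ _ (borel_rV R n) _ D (fun y => P y (X t @^-1` B))
    & forall x (s t : R) (B : set (borel_rV R n)) (H : set T),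
        D x -> 0 <= s -> 0 <= t -> measurable B -> sigma_X `[0, s] H ->
        P x (H `&` X (s + t) @^-1` B)
        = (\int[P x]_(w in H) P (X s w) (X t @^-1` B))%E].

Definition rcll_paths : Prop :=
  forall w (t : R), 0 <= t ->
    (X u w @[u --> t^'+] --> X t w) /\
    (0 < t -> exists l : 'rV[R]_n, X u w @[u --> t^'-] --> l).

Definition stochastically_continuous : Prop :=
  forall x (t0 eps : R), D x -> 0 <= t0 -> 0 < eps ->
    P x [set w | eps < `|X t w - X t0 w|]
      @[t --> within [set t : R | 0 <= t] (nbhs t0)] --> 0%E.

Definition affine_transform : Prop :=
  exists (phi : R -> 'rV[R[i]]_n -> R[i])
         (psi : R -> 'rV[R[i]]_n -> 'rV[R[i]]_n),
    forall x (t : R) (u : 'rV[R[i]]_n), D x -> 0 <= t -> (forall k, complex.Re (u 0 k) = 0) ->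
      cexpectation (P x) (fun w => cexp (cdot u (X t w)))
      = cexp (phi t u + cdot (psi t u) x).

Definition semigroup (t : R) f : 'rV[R]_n -> R :=
  fun x => \int[P x]_(w in setT) f (X t w).

Definition feller : Prop :=
  (forall (t : R) f, 0 <= t -> C0 f -> C0 (semigroup t f)) /\
  (forall f, C0 f -> forall eps : R, 0 < eps ->
    \forall t \near 0^'+, forall x, D x -> `|semigroup t f x - f x| < eps).

(* The graph of the generator in C_0(D) with the supremum norm. *)
Definition generator f g : Prop :=
  [/\ C0 f, C0 g & forall eps : R, 0 < eps ->
    \forall t \near 0^'+, forall x, D x ->
      `|(semigroup t f x - f x) / t - g x| < eps].

(* The second conjunct says that C_c^2(D) is a core. *)
Definition has_affine_generator A : Prop :=
  (forall f, C2c f -> generator f (affine_generator A f)) /\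
  (forall f g, generator f g -> forall eps : R, 0 < eps ->
    exists2 f0, C2c f0 & forall x, D x ->
      `|f0 x - f x| < eps /\ `|affine_generator A f0 x - g x| < eps).

Record affine_process A : Prop := AffineProcess {
  aff_markov : markov_process;
  aff_rcll : rcll_paths;
  aff_H1 : stochastically_continuous;
  aff_H2 : affine_transform;
  aff_feller : feller;
  aff_admissible : admissible A;
  aff_generator : has_affine_generator A }.

Definition standard_exponential_indep (E : T -> R) : Prop :=
  measurable_fun setT E /\
  forall x, D x ->
    (forall B : set R, measurable B ->
       P x (E @^-1` B) = exponential_prob 1 B) /\
    (forall (B : set R) (H : set T), measurable B -> sigma_X `[0, +oo[ H ->
       P x (H `&` E @^-1` B) = (P x H * P x (E @^-1` B))%E).

End Process.
End Affine.

Record stock_param (R : realType) (n m : nat) := StockParam {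
  sp_e : R;
  sp_eps : 'rV[R]_n;
  sp_d : R;
  sp_delta : 'rV[R]_m;
  sp_c : R;
  sp_gamma : 'rV[R]_m;
  sp_d_ge0 : 0 <= sp_d;
  sp_delta_ge0 : forall i, 0 <= sp_delta 0 i;
  sp_c_ge0 : 0 <= sp_c;
  sp_gamma_ge0 : forall i, 0 <= sp_gamma 0 i }.

Section Stock.
Context (R : realType) (n m : nat) (hmn : (m <= n)%N).
Context (d : measure_display) (T : measurableType d).
Context (P : 'rV[R]_n -> probability T R) (X : R -> T -> 'rV[R]_n).
Context (E : T -> R) (sp : stock_param R n m).

Definition subvecI (x : 'rV[R]_n) : 'rV[R]_m := \row_i x 0 (widen_ord hmn i).

Definition s_ (t : R) (w : T) : R := sp_e sp + dot (sp_eps sp) (X t w).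

Definition R_ (t : R) (w : T) : R :=
  \int[@lebesgue_measure R]_(u in `[0, t])
    (sp_d sp + dot (sp_delta sp) (subvecI (X u w))).

Definition Lambda_ (t : R) (w : T) : R :=
  \int[@lebesgue_measure R]_(u in `[0, t])
    (sp_c sp + dot (sp_gamma sp) (subvecI (X u w))).

Definition tau (w : T) : \bar R :=
  ereal_inf [set u%:E | u in [set u : R | 0 <= u /\ Lambda_ u w = E w]].

(* The indicator of {t < tau}. *)
Definition alive (t : R) (w : T) : R := (t%:E < tau w)%E%:R.

Definition S_exponent (t : R) (w : T) : R := s_ t w + R_ t w + Lambda_ t w.

Definition S_ (t : R) (w : T) : R := expR (S_exponent t w) * alive t w.

(* [lne] maps 0 to -oo. *)
Definition logS (t : R) (w : T) : \bar R := lne (S_ t w)%:E.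

(* The discounted moment of real order r, in [0, +oo]. *)
Definition moment (t : R) (x : 'rV[R]_n) (r : R) : \bar R :=
  (\int[P x]_w
    (expR (- R_ t w) * expR (r * S_exponent t w) * alive t w)%:E)%E.

Definition U_ (t : R) (x : 'rV[R]_n) : set R[i] :=
  [set z | (moment t x (complex.Re z) < +oo)%E].

(* Meaningful for z in [U_ t x]; at real arguments [moment] is used instead, as
   it may be infinite. *)
Definition h_ (t : R) (x : 'rV[R]_n) (z : R[i]) : R[i] :=
  cexpectation (P x) (fun w =>
    (expR (- R_ t w))%:C * cexp (z * (S_exponent t w)%:C) * (alive t w)%:C).

Definition price_a (t : R) (x : 'rV[R]_n) (k : R) : \bar R :=
  (\int[P x]_w
    (expR (- R_ t w) * S_ t w * (k%:E < logS t w)%E%:R)%R%:E)%E.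

Definition price_b (t : R) (x : 'rV[R]_n) (k : R) : \bar R :=
  (\int[P x]_w (expR (- R_ t w) * (k%:E < logS t w)%E%:R)%R%:E)%E.

Definition price_c (t : R) (x : 'rV[R]_n) (k : R) : \bar R :=
  (\int[P x]_w (expR (- R_ t w) * Num.max (S_ t w - expR k) 0)%:E)%E.

Definition g_a (t : R) (x : 'rV[R]_n) (p y : R) : R[i] :=
  h_ t x ((p + 1) +i* y) / (p +i* y).

Definition g_b (t : R) (x : 'rV[R]_n) (q y : R) : R[i] :=
  h_ t x (q +i* y) / (q +i* y).

Definition g_c (t : R) (x : 'rV[R]_n) (p y : R) : R[i] :=
  h_ t x ((p + 1) +i* y)
  / ((p ^+ 2 + p - y ^+ 2) +i* (y * (2 * p + 1))).

Definition R_a (t : R) (x : 'rV[R]_n) (p : R) : \bar R :=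
  (if (p < 0)%R then moment t x 1
   else if (p == 0)%R then (2^-1)%:E * moment t x 1
   else 0)%E.

Definition R_b (t : R) (x : 'rV[R]_n) (q : R) : \bar R :=
  (if (q < 0)%R then moment t x 0
   else if (q == 0)%R then (2^-1)%:E * moment t x 0
   else 0)%E.

Definition R_c (t : R) (x : 'rV[R]_n) (k p : R) : \bar R :=
  (if (p < -1)%R then moment t x 1 - (expR k)%:E * moment t x 0
   else if (p == -1)%R then moment t x 1 - (2^-1 * expR k)%:E * moment t x 0
   else if (p < 0)%R then moment t x 1
   else if (p == 0)%R then (2^-1)%:E * moment t x 1
   else 0)%E.

End Stock.

(* V = C + e^(-r k) / pi * int_0^oo Re(e^(-iyk) g(y)) dy, the integral being
   convergent. *)
Definition inversion_formula (R : realType) (V C : \bar R) (r k : R)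
    (g : R -> R[i]) : Prop :=
  exists2 l : R,
    improper_integral (fun y => complex.Re (cexp (0 -i* (y * k)) * g y)) l
    & V = (C + (expR (- r * k) / pi * l)%:E)%E.

(* Main.v *)
(** Write [Z = log S - k].  Re (e^(iyZ) / (p + iy)) is a kernel in [y] whose
integrals over bounded intervals are bounded uniformly in [Z], and whose improper
integral over (0, oo) is [pi e^(-pZ) (sgn p + sgn Z) / 2].  Fubini on bounded
intervals and dominated convergence transfer this to expectations; the terms
[sgn p] produce the residues [R_a], [R_b], [R_c].  For the call,
1 / ((p + iy) (p + 1 + iy)) = 1 / (p + iy) - 1 / (p + 1 + iy).

For [Z > 0] the kernel has an explicit primitive in terms of the sine integral
and arctan, obtained by integrating by parts in [s] the right-hand side of
e^(pZ) Re (e^(iyZ) / (p + iy)) = p / (p^2 + y^2) + int_0^Z e^(ps) cos (ys) ds. *)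

Require Import Defs.
From HB Require Import structures.
From mathcomp Require Import all_boot all_order all_algebra.
From mathcomp Require Import all_classical all_reals all_analysis.
From mathcomp Require Import measurable_realfun.
From mathcomp.real_closed Require Import complex.
From mathcomp Require Import ring lra.
Import Order.TTheory GRing.Theory Num.Theory.
Import numFieldNormedType.Exports.

Set Implicit Arguments.
Unset Strict Implicit.
Unset Printing Implicit Defensive.

Local Open Scope classical_set_scope.
Local Open Scope ring_scope.
Local Open Scope complex_scope.

(** * Integration *)

(** The kernel decays only like 1/y, so its integral over (0, oo) is conditionally convergent and
    Fubini cannot be applied there; for p = 0 it is sin (yZ) / y, whose size near 0 depends on Z.
    Hence intervals [a, N] with a > 0, and a bound free of Z. The integration by parts is made for
    that bound: it trades sin (ys) / s for the bounded sine integral, against a weight p e^(p(s-Z))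
    of constant sign and total mass 1 - e^(-pZ). The mass is at most 1 when pZ >= 0; in the other
    case the kernel at -Z is added and subtracted. A second obstacle is that for p < 0 finiteness of
    the moment of order p + 1 does not give that of order 1, so a residue may be +oo. Prices and
    residues are therefore compared as integrals of nonnegative functions whose difference is
    integrable. *)

Section DominatedConvergence.
Context {R : realType} {d : measure_display} {T : measurableType d}.
Context {mu : {measure set T -> \bar R}} {D : set T} (mD : measurable D).

Lemma Rintegral_dominated_cvg (f_ : nat -> T -> R) (f g : T -> R) :
  (forall n, measurable_fun D (f_ n)) ->
  (forall x, D x -> f_ n x @[n --> \oo] --> f x) ->
  mu.-integrable D (EFin \o g) ->
  (forall n x, D x -> `|f_ n x| <= g x) ->
  mu.-integrable D (EFin \o f) /\
  \int[mu]_(x in D) f_ n x @[n --> \oo] --> \int[mu]_(x in D) f x.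
Proof.
move=> mf_ f_f ig fg.
have mf : measurable_fun D f by exact: (measurable_fun_cvg mf_ f_f).
have [] := @dominated_convergence _ _ _ mu D mD (fun n => EFin \o f_ n)
  (EFin \o f) (EFin \o g).
- by move=> n; apply/measurable_EFinP.
- exact/measurable_EFinP.
- by apply/aeW => x Dx; apply: cvg_EFin; [exact: nearW|exact: f_f].
- exact: ig.
- by apply/aeW => x n Dx; rewrite lee_fin fg.
move=> intf _ cf; split => //.
by apply: fine_cvg; rewrite /Rintegral fineK//; exact: integrable_fin_num.
Qed.

Lemma Rintegral_dominated_cvg_at_right (f_ : R -> T -> R) (f g : T -> R) (a : R) :
  (forall y, a < y -> measurable_fun D (f_ y)) ->
  (forall x, D x -> f_ y x @[y --> a^'+] --> f x) ->
  mu.-integrable D (EFin \o g) ->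
  (forall y x, a < y -> D x -> `|f_ y x| <= g x) ->
  mu.-integrable D (EFin \o f) /\
  \int[mu]_(x in D) f_ y x @[y --> a^'+] --> \int[mu]_(x in D) f x.
Proof.
move=> mf_ f_f ig fg.
have H (u : nat -> R) : (forall n, u n > a) -> u n @[n --> \oo] --> a ->
  mu.-integrable D (EFin \o f) /\
  \int[mu]_(x in D) f_ (u n) x @[n --> \oo] --> \int[mu]_(x in D) f x.
  move=> ua cu; apply: (@Rintegral_dominated_cvg (fun n => f_ (u n)) f g) => //.
  - by move=> n; exact: mf_.
  - by move=> x Dx; move/cvg_at_rightP: (f_f x Dx); apply.
  - by move=> n x; exact: fg.
split.
  apply: (H (fun n => a + n.+1%:R^-1) _ _).1.
    by move=> n; rewrite ltrDl.
  by rewrite -[X in _ --> X]addr0; apply: cvgD; [exact: cvg_cst|exact: cvg_harmonic].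
by apply/cvg_at_rightP => u [ua cu]; have [] := H u ua cu.
Qed.

Lemma Rintegral_dominated_cvg_pinfty (f_ : R -> T -> R) (f g : T -> R) (a : R) :
  (forall y, a < y -> measurable_fun D (f_ y)) ->
  (forall x, D x -> f_ y x @[y --> +oo] --> f x) ->
  mu.-integrable D (EFin \o g) ->
  (forall y x, a < y -> D x -> `|f_ y x| <= g x) ->
  mu.-integrable D (EFin \o f) /\
  \int[mu]_(x in D) f_ y x @[y --> +oo] --> \int[mu]_(x in D) f x.
Proof.
move=> mf_ f_f ig fg.
have H (u : nat -> R) : (forall n, u n > a) -> u n @[n --> \oo] --> +oo ->
  mu.-integrable D (EFin \o f) /\
  \int[mu]_(x in D) f_ (u n) x @[n --> \oo] --> \int[mu]_(x in D) f x.
  move=> ua cu; apply: (@Rintegral_dominated_cvg (fun n => f_ (u n)) f g) => //.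
  - by move=> n; exact: mf_.
  - by move=> x Dx; move/cvg_pinftyP: (f_f x Dx); apply.
  - by move=> n x; exact: fg.
(* The bound holds for parameters beyond [a] only, while a sequence tending to +oo may start below
   it; truncation at [a + 1] changes finitely many terms. *)
have maxgt (r : R) : Num.max r (a + 1) > a by rewrite lt_max ltrDl ltr01 orbT.
split.
  apply: (H (fun n => Num.max n%:R (a + 1)) _ _).1 => //.
  apply/cvgryPge => A; near=> n; rewrite le_max; apply/orP; left.
  by near: n; exact: nbhs_infty_ger.
apply/cvg_pinftyP => u cu.
have cm : Num.max (u n) (a + 1) @[n --> \oo] --> +oo.
  apply/cvgryPge => A; move/cvgryPge/(_ A): cu; apply: filterS => n.
  by rewrite le_max => ->.
have [_] := H (fun n => Num.max (u n) (a + 1)) (fun n => maxgt _) cm.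
apply: cvg_trans; apply: near_eq_cvg.
move/cvgryPge/(_ (a + 1)): cu; apply: filterS => n au.
by rewrite max_l.
Unshelve. all: by end_near. Qed.

End DominatedConvergence.

Lemma Rintegral_derive (R : realType) (F f : R -> R) (a b : R) : a <= b ->
  (forall x, a <= x <= b -> is_derive x 1 F (f x)) ->
  (forall x, a <= x <= b -> {for x, continuous f}) ->
  (@lebesgue_measure R).-integrable `[a, b] (EFin \o f) /\
  \int[lebesgue_measure]_(x in `[a, b]) f x = F b - F a.
Proof.
move=> ab dF cf.
have cf' : {within `[a, b], continuous f}.
  apply: continuous_in_subspaceT => x; rewrite inE /= in_itv/=; exact: cf.
split.
  by apply: continuous_compact_integrable => //; exact: segment_compact.
have [->|nab] := eqVneq a b.
  by rewrite set_itv1 Rintegral_set1 subrr.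
have {}ab : a < b by rewrite lt_neqAle nab.
rewrite /Rintegral (@continuous_FTC2 _ f F)//.
  split.
  - move=> x; rewrite in_itv/= => /andP[ax xb].
    by have := dF x; rewrite (ltW ax) (ltW xb) => /(_ isT) [].
  - apply: cvg_at_right_filter.
    have /derivable1_diffP/differentiable_continuous : derivable F a 1.
      by have := dF a; rewrite lexx (ltW ab) => /(_ isT) [].
    exact.
  - apply: cvg_at_left_filter.
    have /derivable1_diffP/differentiable_continuous : derivable F b 1.
      by have := dF b; rewrite lexx (ltW ab) => /(_ isT) [].
    exact.
move=> x; rewrite in_itv/= => /andP[ax xb].
rewrite derive1E; have := dF x; rewrite (ltW ax) (ltW xb) => /(_ isT) dFx.
exact: derive_val.
Qed.

Lemma ge0_integrable (d : measure_display) (T : measurableType d) (R : realType)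
    (mu : {measure set T -> \bar R}) (D : set T) (f : T -> R) :
  measurable D -> measurable_fun D f -> (forall x, D x -> 0 <= f x) ->
  (\int[mu]_(x in D) (f x)%:E < +oo)%E -> mu.-integrable D (EFin \o f).
Proof.
move=> mD mf f0 foo; apply/integrableP; split; first exact/measurable_EFinP.
apply: le_lt_trans foo; rewrite le_eqVlt; apply/orP; left; apply/eqP.
by apply: eq_integral => x; rewrite inE => Dx /=; rewrite ger0_norm ?f0.
Qed.

(** * The sine integral *)

Section SineIntegral.
Context {R : realType}.
Notation mu := (@lebesgue_measure R).

(** Writing 1/u as the integral of e^(-su) over s > 0 turns int_x^oo sin u / u du into an integral
    over s, with integrand int_x^oo e^(-su) sin u du; this is its closed form. *)
Definition sineint_rem (x s : R) : R :=
  expR (- (s * x)) * (cos x + s * sin x) / (1 + s ^+ 2).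

(* The Laplace-transform form of int_0^x sin u / u du, valid for x > 0: its
   derivative, its bound and its limits at 0 and +oo are read off the integrand. *)
Definition sineint (x : R) : R :=
  pi / 2 - \int[mu]_(s in `]0, +oo[) sineint_rem x s.

Lemma normr_sin_le (x : R) : 0 <= x -> `|sin x| <= x.
Proof.
move=> x0; have [->|xn0] := eqVneq x 0; first by rewrite sin0 normr0.
have {xn0}x0' : 0 < x by rewrite lt_neqAle eq_sym xn0.
have [|c _] := @MVT R sin cos 0 x x0'.
- by apply: continuous_subspaceT; exact: continuous_sin.
rewrite sin0 !subr0 => ->; rewrite normrM (ger0_norm x0) ler_piMl//.
exact: cos_max.
Qed.

Lemma add1_sqr_gt0 (s : R) : 0 < 1 + s ^+ 2.
Proof. by rewrite ltr_wpDr// sqr_ge0. Qed.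

(** The term s sin x grows with s, but |sin x| <= x and s x <= e^(sx) absorb it. The majorant is
    free of x, so it serves both limits of the sine integral. *)
Lemma sineint_rem_bound (x s : R) : 0 <= x -> 0 <= s ->
  `|sineint_rem x s| <= 2 * (1 + s ^+ 2)^-1.
Proof.
move=> x0 s0; rewrite /sineint_rem normrM.
rewrite [X in _ * X]gtr0_norm ?invr_gt0 ?add1_sqr_gt0//.
rewrite ler_wpM2r ?invr_ge0 ?(ltW (add1_sqr_gt0 _))//.
rewrite mulrDr; apply: le_trans (ler_normD _ _) _.
rewrite (_ : 2 = 1 + 1)//; apply: lerD.
  rewrite normrM (ger0_norm (expR_ge0 _)) -[leRHS]mulr1 ler_pM ?expR_ge0//.
    by rewrite expR_le1 oppr_le0 mulr_ge0.
  exact: cos_max.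
rewrite !normrM (ger0_norm (expR_ge0 _)) (ger0_norm s0) expRN.
rewrite mulrC ler_pdivrMr ?expR_gt0// mul1r.
apply: (@le_trans _ _ (s * x)); first by rewrite ler_wpM2l// normr_sin_le.
by apply: le_trans (expR_ge1Dx _); rewrite lerDr.
Qed.

Lemma oneDsqr_invr_integral :
  mu.-integrable `]0, +oo[ (EFin \o (fun s : R => (1 + s ^+ 2)^-1)) /\
  \int[mu]_(s in `]0, +oo[) (1 + s ^+ 2)^-1 = pi / 2 :> R.
Proof.
have cf : continuous (fun s : R => (1 + s ^+ 2)^-1).
  move=> x; apply: cvgV; first by rewrite gt_eqF// add1_sqr_gt0.
  by apply: cvgD; [exact: cvg_cst|exact: exprn_continuous].
have mf : measurable_fun setT (fun s : R => (1 + s ^+ 2)^-1).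
  exact: continuous_measurable_fun.
have E : (\int[mu]_(s in `]0%R, +oo[) ((1 + s ^+ 2)^-1)%:E = (pi / 2)%:E)%E.
  rewrite integral_itv_obnd_cbnd; last first.
    by apply/measurable_EFinP; exact: measurable_funTS.
  rewrite (@ge0_continuous_FTC2y _ _ (@atan R) 0 (pi / 2)).
  - by rewrite atan0 sube0.
  - by move=> x _; rewrite invr_ge0 ltW// add1_sqr_gt0.
  - exact: continuous_subspaceT.
  - exact: cvgy_atan.
  - by move=> x _; exact: derivable_atan.
  - by apply: cvg_at_right_filter; exact: continuous_atan.
  - by move=> x _; rewrite derive1_atan.
split; last by rewrite /Rintegral E.
apply: ge0_integrable => //; first exact: measurable_funTS.
  by move=> s _; rewrite invr_ge0 ltW// add1_sqr_gt0.
by rewrite E ltry.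
Qed.

Lemma measurable_sineint_rem (x : R) : measurable_fun setT (sineint_rem x).
Proof.
apply: continuous_measurable_fun => s; rewrite /sineint_rem.
apply: cvgM; first apply: cvgM.
- apply: continuous_comp; last exact: continuous_expR.
  by apply: cvgN; apply: cvgMr_tmp; exact: cvg_id.
- apply: cvgD; first exact: cvg_cst.
  by apply: cvgMr_tmp; exact: cvg_id.
- apply: cvgV; first by rewrite gt_eqF// add1_sqr_gt0.
  by apply: cvgD; [exact: cvg_cst|exact: exprn_continuous].
Qed.

Let intb : mu.-integrable `]0, +oo[ (EFin \o (fun s : R => 2 * (1 + s ^+ 2)^-1)).
Proof.
rewrite (_ : _ \o _ = (fun s : R => (2%:E * ((1 + s ^+ 2)^-1)%:E)%E)); last first.
  by apply/funext => s /=; rewrite EFinM.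
by apply: integrableZl => //; exact: oneDsqr_invr_integral.1.
Qed.

Lemma integrable_sineint_rem (x : R) : 0 <= x ->
  mu.-integrable `]0, +oo[ (EFin \o sineint_rem x).
Proof.
move=> x0; apply: le_integrable intb => //.
  by apply/measurable_EFinP; apply: measurable_funTS; exact: measurable_sineint_rem.
move=> s /=; rewrite in_itv/= andbT => s0; rewrite lee_fin.
rewrite [leRHS]ger0_norm; first exact: sineint_rem_bound (ltW s0).
by rewrite mulr_ge0// invr_ge0 ltW// add1_sqr_gt0.
Qed.

(** The remainder contributes at most twice the integral of 1 / (1 + s^2), hence the second [pi]. *)
Lemma sineint_bound (x : R) : 0 <= x -> `|sineint x| <= pi / 2 + pi.
Proof.
move=> x0; apply: le_trans (ler_normB _ _) _; apply: lerD.
  by rewrite ger0_norm// divr_ge0// pi_ge0.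
have irem := integrable_sineint_rem x0.
apply: le_trans; first exact: le_normr_Rintegral irem.
apply: (@le_trans _ _ (\int[mu]_(s in `]0, +oo[) (2 * (1 + s ^+ 2)^-1))).
  apply: le_Rintegral => //.
    by have := integrable_norm irem.
  move=> s /=; rewrite in_itv/= andbT => s0.
  by apply: sineint_rem_bound => //; exact: ltW.
rewrite RintegralZl//; last exact: oneDsqr_invr_integral.1.
by rewrite oneDsqr_invr_integral.2; lra.
Qed.

Lemma sineint_cvg0 : sineint x @[x --> 0^'+] --> 0.
Proof.
rewrite -[X in _ --> X](subrr (pi / 2)); apply: cvgB; first exact: cvg_cst.
(* At x = 0 the integrand of the remainder is 1 / (1 + s^2), so [pi / 2] is the integral of the
   pointwise limit. *)
rewrite -oneDsqr_invr_integral.2.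
apply: (@Rintegral_dominated_cvg_at_right R _ _ mu `]0, +oo[ (measurable_itv _) sineint_rem (fun s : R => (1 + s ^+ 2)^-1) (fun s => 2 * (1 + s ^+ 2)^-1) _ _ _ _ _).2 => //.
- by move=> y _; apply: measurable_funTS; exact: measurable_sineint_rem.
- move=> s _; apply: cvg_at_right_filter.
  rewrite [X in _ --> X](_ : _ = expR (- (s * 0)) * (cos 0 + s * sin 0) / (1 + s ^+ 2)); last first.
    by rewrite mulr0 oppr0 expR0 sin0 cos0 mulr0 addr0 !mul1r.
  apply: cvgM; last exact: cvg_cst.
  apply: cvgM.
    apply: continuous_comp; last exact: continuous_expR.
    by apply: cvgN; apply: cvgMl_tmp; exact: cvg_id.
  apply: cvgD; first exact: continuous_cos.
  by apply: cvgMl_tmp; exact: continuous_sin.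
- move=> y s y0 /=; rewrite in_itv/= andbT => s0.
  by apply: sineint_rem_bound => //; exact: ltW.
Qed.

Lemma sineint_cvgy : sineint x @[x --> +oo] --> (pi / 2 : R).
Proof.
rewrite -[X in _ --> X]subr0; apply: cvgB; first exact: cvg_cst.
rewrite [X in _ --> X](_ : _ = \int[mu]_(s in `]0, +oo[) (fun=> 0) s); last first.
  by rewrite Rintegral_cst// mul0r.
apply: (@Rintegral_dominated_cvg_pinfty R _ _ mu `]0, +oo[ (measurable_itv _) sineint_rem (fun=> 0) (fun s => 2 * (1 + s ^+ 2)^-1) 0 _ _ _ _).2 => //.
- by move=> y _; apply: measurable_funTS; exact: measurable_sineint_rem.
- move=> s /=; rewrite in_itv/= andbT => s0.
  have E0 : expR (- (s * x)) @[x --> +oo] --> (0 : R).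
    have := @cvgr_expR R; apply: cvg_comp.
    apply/cvgryPge => A; have := nbhs_pinfty_ge (num_real (s^-1 * A)); apply: filterS => y.
    by rewrite ler_pdivrMl.
  have bnd y : `|sineint_rem y s| <= expR (- (s * y)) * ((1 + s) / (1 + s ^+ 2)).
    rewrite /sineint_rem !normrM (ger0_norm (expR_ge0 _)) -mulrA.
    rewrite ler_wpM2l ?expR_ge0// [X in _ * X <= _]gtr0_norm ?invr_gt0 ?add1_sqr_gt0//.
    rewrite ler_wpM2r ?invr_ge0 ?(ltW (add1_sqr_gt0 _))//.
    apply: le_trans (ler_normD _ _) _; apply: lerD; first exact: cos_max.
    by rewrite normrM (gtr0_norm s0) ler_piMr ?(ltW s0) ?sin_max.
  apply: norm_cvg0.
  apply: (@squeeze_cvgr _ _ _ _ (fun=> 0) (fun y => expR (- (s * y)) * ((1 + s) / (1 + s ^+ 2)))).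
  + by apply/nearW => y; rewrite normr_ge0 /=; exact: bnd.
  + exact: cvg_cst.
  + rewrite -[X in _ --> X](mul0r ((1 + s) / (1 + s ^+ 2))).
    by apply: cvgMr_tmp.
- move=> y s y0 /=; rewrite in_itv/= andbT => s0.
  by apply: sineint_rem_bound => //; exact: ltW.
Qed.

(** Used twice for the derivative of the sine integral: as an integrable majorant and as the value
    of the differentiated integral. *)
Lemma expR_laplace (a : R) : 0 < a ->
  mu.-integrable `]0, +oo[ (EFin \o (fun s : R => expR (- (s * a)))) /\
  \int[mu]_(s in `]0, +oo[) expR (- (s * a)) = a^-1.
Proof.
move=> a0.
have D (s : R) : is_derive s 1 (fun s => - (a^-1 * expR (- (s * a)))) (expR (- (s * a))).
  apply: is_derive_eq.
  by rewrite /GRing.scale/=; field; rewrite gt_eqF.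
have cf : continuous (fun s : R => expR (- (s * a))).
  move=> s; apply: continuous_comp; last exact: continuous_expR.
  by apply: cvgN; apply: cvgMr_tmp; exact: cvg_id.
have mf : measurable_fun setT (fun s : R => expR (- (s * a))).
  exact: continuous_measurable_fun.
have E : (\int[mu]_(s in `]0%R, +oo[) (expR (- (s * a)))%:E = (a^-1)%:E)%E.
  rewrite integral_itv_obnd_cbnd; last first.
    by apply/measurable_EFinP; exact: measurable_funTS.
  rewrite (@ge0_continuous_FTC2y _ _ (fun s => - (a^-1 * expR (- (s * a)))) 0 0).
  - by rewrite mul0r oppr0 expR0 mulr1 EFinN oppeK add0e.
  - by move=> x _; exact: expR_ge0.
  - exact: continuous_subspaceT.
  - rewrite -oppr0 -(mulr0 a^-1); apply: cvgN; apply: cvgMl_tmp.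
    have := @cvgr_expR R; apply: cvg_comp.
    apply/cvgryPge => A; have := nbhs_pinfty_ge (num_real (A / a)); apply: filterS => y.
    by rewrite ler_pdivrMr.
  - by move=> x _; have [] := D x.
  - apply: cvg_at_right_filter.
    by have [/derivable1_diffP/differentiable_continuous] := D 0.
  - by move=> x _; rewrite derive1E; apply: derive_val.
split; last by rewrite /Rintegral E.
apply: ge0_integrable => //; first exact: measurable_funTS.
by rewrite E ltry.
Qed.

(** Differentiating the remainder in x cancels the denominator 1 + s^2 and leaves - sin x e^(-sx), a
    Laplace integral. The neighbourhood [I] stays above x / 2, so that e^(-s x/2) dominates. *)
Lemma is_derive_sineint (x : R) : 0 < x -> is_derive x 1 sineint (sin x / x).
Proof.
move=> x0.
pose I : set R := `]x / 2, x + 1[%classic.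
have Ix : I x by rewrite /I/= in_itv/= ltrDl ltr01 andbT; lra.
have Igt0 y : I y -> x / 2 < y by rewrite /I/= in_itv/= => /andP[].
have Dr (y s : R) : is_derive y 1 (sineint_rem ^~ s) (- (sin y * expR (- (s * y)))).
  rewrite /sineint_rem; apply: is_derive_eq.
  rewrite /GRing.scale/=; field.
  by rewrite gt_eqF// add1_sqr_gt0.
have D1 (y s : R) : partial1of2 sineint_rem y s = - (sin y * expR (- (s * y))).
  by rewrite partial1of2E; apply: derive_val.
have intf y : I y -> mu.-integrable `]0, +oo[ (EFin \o sineint_rem y).
  by move=> /Igt0 yx; apply: integrable_sineint_rem; lra.
have derf y (s : R) : I y -> `]0, +oo[%classic s -> derivable (sineint_rem ^~ s) y 1.
  by move=> _ _; have [] := Dr y s.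
have G0 (s : R) : 0 <= expR (- (s * (x / 2))) by exact: expR_ge0.
have x20 : 0 < x / 2 by lra.
have Gub y (s : R) : I y -> `]0, +oo[%classic s ->
    `|partial1of2 sineint_rem y s| <= expR (- (s * (x / 2))).
  move=> /Igt0 yx /=; rewrite in_itv/= andbT => s0.
  rewrite D1 normrN normrM (ger0_norm (expR_ge0 _)) -[leRHS]mul1r.
  rewrite ler_pM ?expR_ge0// ?sin_max// ler_expR lerN2 ler_wpM2l// ltW//.
have mi : measurable (`]0, +oo[%classic : set (measurableTypeR R)) by [].
have dF := derivable_under_integral mi Ix intf derf G0 (expR_laplace x20).1 Gub.
have eF := differentiation_under_integral mi Ix intf derf G0 (expR_laplace x20).1 Gub.
rewrite derive1E in eF.
have := DeriveDef dF eF => {}dF.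
rewrite /sineint; apply: is_derive_eq.
rewrite add0r mul1r (@eq_Rintegral _ _ _ mu _ (fun s : R => (- sin x) * expR (- (s * x)))); last first.
  by move=> s _; rewrite D1 mulNr.
rewrite RintegralZl//; last exact: (expR_laplace x0).1.
by rewrite (expR_laplace x0).2 mulNr opprK.
Qed.

End SineIntegral.

(** * The inversion kernel *)

Section InversionKernel.
Context {R : realType}.
Notation mu := (@lebesgue_measure R).

Definition kernel (p y z : R) : R :=
  (p * cos (y * z) + y * sin (y * z)) / (p ^+ 2 + y ^+ 2).

Definition kernel_limit (p z : R) : R :=
  expR (- (p * z)) * (Num.sg p + Num.sg z) / 2.

Lemma den_gt0 (p y : R) : 0 < y -> 0 < p ^+ 2 + y ^+ 2.
Proof. by move=> y0; rewrite ltr_wpDl ?sqr_ge0// exprn_gt0. Qed.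

(* For [p = 0] the convention [y / 0 = 0] makes the arctan term vanish, as it should. *)
Definition kernel_primitive_pos (p z y : R) : R :=
  expR (- (p * z)) * atan (y / p) + sineint (y * z)
  - \int[mu]_(s in `]0, z[) (p * expR (p * (s - z)) * sineint (y * s)).

Lemma continuous_sineint (x : R) : 0 < x -> {for x, continuous sineint}.
Proof.
move=> /is_derive_sineint[/derivable1_diffP/differentiable_continuous].
exact.
Qed.

Lemma is_derive_comp_mulr (f : R -> R) (c x a : R) :
  is_derive (x * c) 1 f a -> is_derive x 1 (fun y => f (y * c)) (a * c).
Proof.
move=> df; apply: (@is_derive1_comp R f (fun y => y * c)).
by apply: is_derive_eq; rewrite /GRing.scale/=; ring.
Qed.

Lemma is_derive_atan_div (p y : R) : 0 < y ->
  is_derive y 1 (fun y => atan (y / p)) (p / (p ^+ 2 + y ^+ 2)).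
Proof.
move=> y0; have [->|p0] := eqVneq p 0.
  rewrite (_ : (fun _ => _) = cst 0).
    by rewrite mul0r; exact: is_derive_cst.
  by apply/funext => u; rewrite invr0 mulr0 atan0.
have D3 := is_derive_comp_mulr (is_derive1_atan (y / p)).
apply: is_derive_eq; have := den_gt0 p y0 => h; field.
by rewrite p0 gt_eqF.
Qed.

(** A crude bound that grows with z; it is used for domination at fixed p and z only. *)
Lemma expR_weight_bound (p z s : R) : 0 <= s <= z ->
  expR (p * (s - z)) <= expR (`|p| * z).
Proof.
move=> /andP[s0 sz]; rewrite ler_expR.
apply: le_trans (ler_norm _) _; rewrite normrM ler_wpM2l//.
by rewrite distrC ger0_norm; lra.
Qed.

Lemma measurable_sineint_scaled (p z y : R) : 0 < y ->
  measurable_fun `]0, z[ (fun s => p * expR (p * (s - z)) * sineint (y * s)).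
Proof.
move=> y0; apply: open_continuous_measurable_fun; first exact: interval_open.
move=> s; rewrite inE/= in_itv/= => /andP[s0 sz].
apply: cvgM.
  apply: cvgMl_tmp; apply: continuous_comp; last exact: continuous_expR.
  apply: cvgMl_tmp; apply: cvgB; [exact: cvg_id|exact: cvg_cst].
apply: continuous_comp; first by apply: cvgMl_tmp; exact: cvg_id.
by apply: continuous_sineint; rewrite mulr_gt0.
Qed.

Lemma integrable_cst_itv (a b c : R) : mu.-integrable `]a, b[ (EFin \o (fun=> c)).
Proof.
apply/integrableP; split; first by apply/measurable_EFinP.
rewrite integral_cst//= lebesgue_measure_itv/=; case: ifP => _.
  by rewrite -EFinB -EFinM ltry.
by rewrite mule0 ltry.
Qed.

Lemma sineint_scaled_bound (p z y s : R) : 0 < y -> 0 < s < z ->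
  `|p * expR (p * (s - z)) * sineint (y * s)| <= `|p| * expR (`|p| * z) * (pi / 2 + pi).
Proof.
move=> y0 /andP[s0 sz]; rewrite !normrM (ger0_norm (expR_ge0 _)).
apply: ler_pM; rewrite ?mulr_ge0 ?expR_ge0//.
  by rewrite ler_wpM2l// expR_weight_bound// !ltW.
by apply: sineint_bound; rewrite mulr_ge0 ?ltW.
Qed.

Lemma integrable_sineint_scaled (p z y : R) : 0 < y ->
  mu.-integrable `]0, z[ (EFin \o (fun s => p * expR (p * (s - z)) * sineint (y * s))).
Proof.
move=> y0; apply: (le_integrable _ _ _ (integrable_cst_itv 0 z (`|p| * expR (`|p| * z) * (pi / 2 + pi)))) => //.
  by apply/measurable_EFinP; exact: measurable_sineint_scaled.
move=> s /=; rewrite in_itv/= => sz; rewrite lee_fin.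
by apply: le_trans (ler_norm _); exact: sineint_scaled_bound.
Qed.

(** The weight is the derivative of e^(p(s-z)). Its mass enters the limit of the primitive at +oo
    and, being at most 1 for p >= 0, the bound uniform in z. *)
Lemma integral_expR_weight (p z : R) : 0 <= z ->
  mu.-integrable `]0, z[ (EFin \o (fun s => p * expR (p * (s - z)))) /\
  \int[mu]_(s in `]0, z[) (p * expR (p * (s - z))) = 1 - expR (- (p * z)).
Proof.
move=> z0.
have D (s : R) : is_derive s 1 (fun s => expR (p * (s - z))) (p * expR (p * (s - z))).
  by apply: is_derive_eq; rewrite /GRing.scale/=; ring.
have c (s : R) : {for s, continuous (fun s => p * expR (p * (s - z)))}.
  apply: cvgMl_tmp; have [/derivable1_diffP/differentiable_continuous] := D s; exact.
have [i e] := Rintegral_derive z0 (fun s _ => D s) (fun s _ => c s).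
have io : mu.-integrable `]0, z[ (EFin \o (fun s => p * expR (p * (s - z)))).
  by apply: integrableS i => //; exact: subset_itv_oo_cc.
split => //.
have io' : mu.-integrable `]0, z] (EFin \o (fun s => p * expR (p * (s - z)))).
  by apply: integrableS i => //; exact: subset_itv_oc_cc.
rewrite Rintegral_itv_bndo_bndc// Rintegral_itv_obnd_cbnd// e.
by rewrite subrr mulr0 expR0 sub0r mulrN.
Qed.

(** Under the integral, [sineint (u * s)] differentiates to sin (us) / u, and what remains is
    elementary. Its e^(-pz) term cancels the derivative of the arctan term. *)
Lemma is_derive_kernel_primitive_pos (p z y : R) : 0 < z -> 0 < y ->
  is_derive y 1 (kernel_primitive_pos p z) (kernel p y z).
Proof.
move=> z0 y0.
pose I : set R := `]y / 2, y + 1[%classic.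
have Iy : I y by rewrite /I/= in_itv/= ltrDl ltr01 andbT; lra.
have Igt0 u : I u -> y / 2 < u by rewrite /I/= in_itv/= => /andP[].
pose f u s := p * expR (p * (s - z)) * sineint (u * s).
have Dr (u s : R) : 0 < u -> 0 < s ->
    is_derive u 1 (f ^~ s) (p * expR (p * (s - z)) * (sin (u * s) / u)).
  move=> u0 s0; rewrite /f.
  have us : 0 < u * s by rewrite mulr_gt0.
  have D3 := is_derive_comp_mulr (is_derive_sineint us).
  apply: is_derive_eq; rewrite /GRing.scale/=.
  by field; rewrite !gt_eqF.
have intf u : I u -> mu.-integrable `]0, z[ (EFin \o f u).
  by move=> /Igt0 yu; apply: integrable_sineint_scaled; lra.
have derf (u s : R) : I u -> `]0, z[%classic s -> derivable (f ^~ s) u 1.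
  move=> /Igt0 yu /=; rewrite in_itv/= => /andP[s0 _].
  by have [] := Dr u s _ s0; first lra.
(* On [I] one has u > y / 2, so |sin (us) / u| is at most 1 / (y / 2). *)
pose G : R -> R := fun=> `|p| * expR (`|p| * z) / (y / 2).
have y2 : 0 < y / 2 by lra.
have G0 (s : R) : 0 <= G s by apply: divr_ge0; [rewrite mulr_ge0 ?expR_ge0|exact: ltW].
have D1 (u s : R) : 0 < u -> 0 < s ->
    partial1of2 f u s = p * expR (p * (s - z)) * (sin (u * s) / u).
  by move=> u0 s0; rewrite partial1of2E; have ? := Dr u s u0 s0; apply: derive_val.
have Gub (u s : R) : I u -> `]0, z[%classic s -> `|partial1of2 f u s| <= G s.
  move=> /Igt0 yu /=; rewrite in_itv/= => /andP[s0 sz].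
  have u0 : 0 < u by lra.
  rewrite D1// !normrM (ger0_norm (expR_ge0 _)) /G.
  apply: ler_pM; rewrite ?mulr_ge0 ?expR_ge0//.
    by rewrite ler_wpM2l// expR_weight_bound// !ltW.
  rewrite -[leRHS]mul1r ler_pM ?sin_max// gtr0_norm ?invr_gt0//.
  by rewrite lef_pV2 ?posrE// ltW.
have mi : measurable (`]0, z[%classic : set (measurableTypeR R)) by [].
have intG := integrable_cst_itv 0 z (`|p| * expR (`|p| * z) / (y / 2)).
have dF := derivable_under_integral mi Iy intf derf G0 intG Gub.
have eF := differentiation_under_integral mi Iy intf derf G0 intG Gub.
rewrite derive1E in eF.
have := DeriveDef dF eF => {}dF.
have yz : 0 < y * z by rewrite mulr_gt0.
have E1 : is_derive y 1 (fun y => sineint (y * z)) (sin (y * z) / y).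
  have D3 := is_derive_comp_mulr (is_derive_sineint yz).
  by apply: is_derive_eq; field; rewrite ?gt_eqF ?andbT.
have E2 := is_derive_atan_div p y0.
have E3 : \int[mu]_(s in `]0, z[) partial1of2 f y s =
    p * (p * sin (y * z) - y * cos (y * z) + y * expR (- (p * z))) / (p ^+ 2 + y ^+ 2) / y.
  (* The classical primitive of e^(p(s-z)) sin (ys), scaled by p / y. *)
  have D (s : R) : is_derive s 1
     (fun s => p / y / (p ^+ 2 + y ^+ 2) * (expR (p * (s - z)) * (p * sin (y * s) - y * cos (y * s))))
     (p * expR (p * (s - z)) * (sin (y * s) / y)).
    apply: is_derive_eq; rewrite /GRing.scale/=.
    by field; rewrite !gt_eqF// den_gt0.
  have c (s : R) : {for s, continuous (fun s => p * expR (p * (s - z)) * (sin (y * s) / y))}.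
    apply: cvgM.
      apply: cvgMl_tmp; apply: continuous_comp; last exact: continuous_expR.
      apply: cvgMl_tmp; apply: cvgB; [exact: cvg_id|exact: cvg_cst].
    apply: cvgMr_tmp; apply: continuous_comp; last exact: continuous_sin.
    by apply: cvgMl_tmp; exact: cvg_id.
  have [i e] := Rintegral_derive (ltW z0) (fun s _ => D s) (fun s _ => c s).
  rewrite (@eq_Rintegral _ _ _ mu _ (fun s : R => p * expR (p * (s - z)) * (sin (y * s) / y))); last first.
    by move=> s; rewrite inE/= in_itv/= => /andP[s0 _]; rewrite D1.
  have io : mu.-integrable `]0, z[ (EFin \o (fun s => p * expR (p * (s - z)) * (sin (y * s) / y))).
    by apply: integrableS i => //; exact: subset_itv_oo_cc.
  have io' : mu.-integrable `]0, z] (EFin \o (fun s => p * expR (p * (s - z)) * (sin (y * s) / y))).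
    by apply: integrableS i => //; exact: subset_itv_oc_cc.
  rewrite Rintegral_itv_bndo_bndc// Rintegral_itv_obnd_cbnd// e.
  rewrite subrr !mulr0 expR0 sin0 cos0 sub0r !mulr0 !mulrN mulr1 mul1r.
  by field; rewrite !gt_eqF// den_gt0.
rewrite /kernel_primitive_pos; apply: is_derive_eq.
rewrite E3 /GRing.scale/= /kernel.
by field; rewrite !gt_eqF// den_gt0.
Qed.

End InversionKernel.

(** * Limits and uniform bounds of the integrated kernel *)

Section KernelIntegral.
Context {R : realType}.
Notation mu := (@lebesgue_measure R).

(** Negative z is reflected by the symmetry [kernelN]; at z = 0 the kernel is p / (p^2 + y^2) and an
    arctan remains. *)
Definition kernel_primitive (p z y : R) : R :=
  if 0 < z then kernel_primitive_pos p z y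
  else if z < 0 then - kernel_primitive_pos (- p) (- z) y
  else atan (y / p).

Lemma kernelN (p y z : R) : kernel p y (- z) = - kernel (- p) y z.
Proof. by rewrite /kernel mulrN cosN sinN sqrrN; ring. Qed.

Lemma is_derive_kernel_primitive (p z y : R) : 0 < y ->
  is_derive y 1 (kernel_primitive p z) (kernel p y z).
Proof.
move=> y0; rewrite /kernel_primitive; have [z0|z0|<-] := ltgtP 0 z.
- exact: is_derive_kernel_primitive_pos.
- have z0' : 0 < - z by rewrite oppr_gt0.
  rewrite -[z in kernel p y z]opprK kernelN.
  have D := is_derive_kernel_primitive_pos (- p) z0' y0.
  by apply: is_derive_eq; rewrite ?scaleN1r ?mulN1r.
- rewrite /kernel mulr0 cos0 sin0 mulr0 addr0 mulr1.
  exact: is_derive_atan_div.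
Qed.

Lemma continuous_kernel (p z y : R) : 0 < y -> {for y, continuous (fun y => kernel p y z)}.
Proof.
move=> y0; apply: cvgM.
  apply: cvgD.
    apply: cvgMl_tmp; apply: continuous_comp; last exact: continuous_cos.
    by apply: cvgMr_tmp; exact: cvg_id.
  apply: cvgM; first exact: cvg_id.
  apply: continuous_comp; last exact: continuous_sin.
  by apply: cvgMr_tmp; exact: cvg_id.
apply: cvgV; first by rewrite gt_eqF// den_gt0.
by apply: cvgD; [exact: cvg_cst|exact: exprn_continuous].
Qed.

Lemma integral_kernel (p z a b : R) : 0 < a -> a <= b ->
  mu.-integrable `[a, b] (EFin \o (fun y => kernel p y z)) /\
  \int[mu]_(y in `[a, b]) kernel p y z =
    kernel_primitive p z b - kernel_primitive p z a.
Proof.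
move=> a0 ab; apply: Rintegral_derive => // y /andP[ay _].
  by apply: is_derive_kernel_primitive; exact: lt_le_trans ay.
by apply: continuous_kernel; exact: lt_le_trans ay.
Qed.

Lemma sineint_scaled_cvg0 (c : R) : 0 < c -> sineint (y * c) @[y --> 0^'+] --> 0.
Proof.
move=> c0; apply/cvg_at_rightP => u [u0 cu].
move/cvg_at_rightP: (@sineint_cvg0 R); apply; split.
  by move=> n; rewrite mulr_gt0.
by rewrite -[X in _ --> X](mul0r c); apply: cvgMr_tmp.
Qed.

Lemma cvgy_mulr (c : R) : 0 < c -> y * c @[y --> +oo] --> +oo.
Proof.
move=> c0; apply/cvgryPge => A.
have := nbhs_pinfty_ge (num_real (A / c)); apply: filterS => y.
by rewrite ler_pdivrMr.
Qed.

Lemma sineint_scaled_cvgy (c : R) : 0 < c ->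
  sineint (y * c) @[y --> +oo] --> pi / 2.
Proof. by move=> c0; apply: cvg_comp (cvgy_mulr c0) (@sineint_cvgy R). Qed.

Lemma atan_div_cvg0 (p : R) : atan (y / p) @[y --> 0^'+] --> 0.
Proof.
have : {for (0 : R), continuous (fun y : R => atan (y / p))}.
  apply: continuous_comp; last exact: continuous_atan.
  by apply: cvgMr_tmp; exact: cvg_id.
by move=> c; have := cvg_at_right_filter c; rewrite mul0r atan0.
Qed.

Lemma atan_div_cvgy (p : R) : atan (y / p) @[y --> +oo] --> Num.sg p * (pi / 2).
Proof.
have pos (q : R) : 0 < q -> atan (y / q) @[y --> +oo] --> pi / 2.
  move=> q0; apply: (cvg_comp (fun y => y / q)); last exact: cvgy_atan.
  by apply: cvgy_mulr; rewrite invr_gt0.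
have [p0|p0|<-] := ltgtP 0 p.
- by rewrite gtr0_sg// mul1r; exact: pos.
- rewrite ltr0_sg// mulN1r (_ : (fun y => _) = (fun y => - atan (y / - p))).
    by apply: cvgN; apply: pos; rewrite oppr_gt0.
  by apply/funext => y; rewrite invrN mulrN atanN opprK.
- rewrite sgr0 mul0r (_ : (fun y => _) = cst 0); first exact: cvg_cst.
  by apply/funext => y; rewrite invr0 mulr0 atan0.
Qed.

(** Every term vanishes at 0+, so the primitive is already normalised as the improper integral from
    0. *)
Lemma kernel_primitive_pos_cvg0 (p z : R) : 0 < z ->
  kernel_primitive_pos p z y @[y --> 0^'+] --> 0.
Proof.
move=> z0; rewrite /kernel_primitive_pos.
rewrite -[X in _ --> X](subrr 0) -[X in _ --> X - _](addr0 0).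
apply: cvgB; first apply: cvgD.
- by rewrite -[X in _ --> X](mulr0 (expR (- (p * z)))); apply: cvgMl_tmp; exact: atan_div_cvg0.
- exact: sineint_scaled_cvg0.
rewrite [X in _ --> X](_ : _ = \int[mu]_(s in `]0, z[) (fun=> 0) s); last first.
  by rewrite Rintegral_cst// mul0r.
apply: (@Rintegral_dominated_cvg_at_right R _ _ mu `]0, z[ (measurable_itv _)
  (fun y s => p * expR (p * (s - z)) * sineint (y * s)) (fun=> 0)
  (fun=> `|p| * expR (`|p| * z) * (pi / 2 + pi)) 0 _ _ _ _).2.
- by move=> y y0; exact: measurable_sineint_scaled.
- move=> s /=; rewrite in_itv/= => /andP[s0 sz].
  rewrite -[X in _ --> X](mulr0 (p * expR (p * (s - z)))); apply: cvgMl_tmp.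
  exact: sineint_scaled_cvg0.
- exact: integrable_cst_itv.
- by move=> y s y0 /=; rewrite in_itv/= => sz; exact: sineint_scaled_bound.
Qed.

(** Both sine integrals tend to pi / 2, the second one under a weight of mass 1 - e^(-pz); the terms
    without e^(-pz) cancel. *)
Lemma kernel_primitive_pos_cvgy (p z : R) : 0 < z ->
  kernel_primitive_pos p z y @[y --> +oo] --> pi * kernel_limit p z.
Proof.
move=> z0; rewrite /kernel_primitive_pos.
have -> : pi * kernel_limit p z =
   expR (- (p * z)) * (Num.sg p * (pi / 2)) + pi / 2
   - (1 - expR (- (p * z))) * (pi / 2).
  by rewrite /kernel_limit (gtr0_sg z0); field.
apply: cvgB; first apply: cvgD.
- by apply: cvgMl_tmp; exact: atan_div_cvgy.
- exact: sineint_scaled_cvgy.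
have [iw ew] := integral_expR_weight p (ltW z0).
rewrite -ew -RintegralZr//.
apply: (@Rintegral_dominated_cvg_pinfty R _ _ mu `]0, z[ (measurable_itv _)
  (fun y s => p * expR (p * (s - z)) * sineint (y * s))
  (fun s => p * expR (p * (s - z)) * (pi / 2))
  (fun=> `|p| * expR (`|p| * z) * (pi / 2 + pi)) 0 _ _ _ _).2.
- by move=> y y0; exact: measurable_sineint_scaled.
- move=> s /=; rewrite in_itv/= => /andP[s0 sz].
  by apply: cvgMl_tmp; exact: sineint_scaled_cvgy.
- exact: integrable_cst_itv.
- by move=> y s y0 /=; rewrite in_itv/= => sz; exact: sineint_scaled_bound.
Qed.

Lemma kernel_limitN (p z : R) : kernel_limit (- p) (- z) = - kernel_limit p z.
Proof. by rewrite /kernel_limit mulrNN !sgrN; field. Qed.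

Lemma kernel_primitive_cvg0 (p z : R) :
  kernel_primitive p z y @[y --> 0^'+] --> 0.
Proof.
rewrite /kernel_primitive; have [z0|z0|_] := ltgtP 0 z.
- exact: kernel_primitive_pos_cvg0.
- rewrite -[X in _ --> X]oppr0; apply: cvgN; apply: kernel_primitive_pos_cvg0.
  by rewrite oppr_gt0.
- exact: atan_div_cvg0.
Qed.

Lemma kernel_primitive_cvgy (p z : R) :
  kernel_primitive p z y @[y --> +oo] --> pi * kernel_limit p z.
Proof.
rewrite /kernel_primitive; have [z0|z0|<-] := ltgtP 0 z.
- exact: kernel_primitive_pos_cvgy.
- rewrite -[X in _ --> X]opprK -mulrN -kernel_limitN; apply: cvgN.
  by apply: kernel_primitive_pos_cvgy; rewrite oppr_gt0.
- rewrite /kernel_limit mulr0 oppr0 expR0 sgr0 addr0 mul1r mulrCA.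
  exact: atan_div_cvgy.
Qed.

Lemma atan_bound (x : R) : `|atan x| <= pi / 2.
Proof. by rewrite ler_norml !ltW// ?atan_gtNpi2 ?atan_ltpi2. Qed.

(** For p >= 0 the weight is nonnegative with mass at most 1 and e^(-pz) <= 1, so no term grows with
    z. The summands bound the arctan, the sine integral and its weighted average. *)
Lemma kernel_primitive_pos_bound (p z y : R) : 0 <= p -> 0 < z -> 0 < y ->
  `|kernel_primitive_pos p z y| <= pi / 2 + (pi / 2 + pi) + (pi / 2 + pi).
Proof.
move=> p0 z0 y0; have [iw ew] := integral_expR_weight p (ltW z0).
have pz0 : 0 <= p * z by rewrite mulr_ge0// ltW.
have iS := integrable_sineint_scaled p z y0.
have S0 : 0 <= pi / 2 + pi :> R by have := @pi_ge0 R; lra.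
apply: le_trans (ler_normB _ _) _; apply: lerD.
  apply: le_trans (ler_normD _ _) _; apply: lerD.
    rewrite normrM (ger0_norm (expR_ge0 _)) -[leRHS]mul1r ler_pM ?expR_ge0//.
      by rewrite expR_le1 oppr_le0.
    exact: atan_bound.
  by apply: sineint_bound; rewrite mulr_ge0 ?ltW.
apply: le_trans; first exact: le_normr_Rintegral iS.
apply: (@le_trans _ _ (\int[mu]_(s in `]0, z[) (p * expR (p * (s - z)) * (pi / 2 + pi)))).
  apply: le_Rintegral => //.
  - by have := integrable_norm iS.
  - rewrite (_ : _ \o _ = (fun s : R => ((p * expR (p * (s - z)))%:E * (pi / 2 + pi)%:E)%E)); last first.
      by apply/funext => s /=; rewrite EFinM.
    exact: integrableZr.
  - move=> s /=; rewrite in_itv/= => /andP[s0 sz].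
    rewrite normrM ger0_norm ?mulr_ge0 ?expR_ge0//.
    rewrite ler_wpM2l ?mulr_ge0 ?expR_ge0// sineint_bound//.
    by rewrite mulr_ge0 ?ltW.
rewrite RintegralZr// ew -[leRHS]mul1r ler_wpM2r// gerBl expR_ge0.
Qed.

(* The bound shows in the primitive only when [p * z >= 0]; then use that
   [kernel p y z + kernel p y (- z)] is dominated by an arctan density. *)
Lemma integral_kernel_bound (p z a b : R) : 0 < a -> a <= b ->
  `|\int[mu]_(y in `[a, b]) kernel p y z| <= 24 * pi.
Proof.
have pi0 := @pi_ge0 R.
(* Each value of the primitive is at most 7 pi / 2, rounded up to 4 pi, and two values are
   subtracted. *)
have same q w c d : 0 <= q * w -> 0 < c -> c <= d ->
    `|\int[mu]_(y in `[c, d]) kernel q y w| <= 8 * pi.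
  move=> qw c0 cd; have d0 : 0 < d by exact: lt_le_trans cd.
  rewrite (integral_kernel q w c0 cd).2 /kernel_primitive.
  apply: le_trans (ler_normB _ _) _.
  have B u : 0 < u -> `|kernel_primitive q w u| <= 4 * pi.
    move=> u0; rewrite /kernel_primitive; have [w0|w0|_] := ltgtP 0 w.
    - have q0 : 0 <= q by rewrite -(pmulr_lge0 _ w0).
      by apply: le_trans (kernel_primitive_pos_bound q0 w0 u0) _; lra.
    - have q0 : 0 <= - q by rewrite oppr_ge0 -(nmulr_lge0 _ w0).
      have w0' : 0 < - w by rewrite oppr_gt0.
      by rewrite normrN; apply: le_trans (kernel_primitive_pos_bound q0 w0' u0) _; lra.
    - by apply: le_trans (atan_bound _) _; lra.
  by have := B _ c0; have := B _ d0; rewrite /kernel_primitive; lra.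
move=> a0 ab; have [pz|pz] := lerP 0 (p * z).
  by apply: le_trans (same _ _ _ _ pz a0 ab) _; lra.
have b0 : 0 < b by exact: lt_le_trans ab.
have Npz : 0 <= p * - z by rewrite mulrN oppr_ge0 ltW.
(* The sum of the kernels at z and -z: the sine parts cancel, and with them the part that is not
   absolutely integrable. *)
pose g y := 2 * (p * cos (y * z) / (p ^+ 2 + y ^+ 2)).
have [i1 _] := integral_kernel p z a0 ab.
have [i2 _] := integral_kernel p (- z) a0 ab.
have eg y : g y = kernel p y z + kernel p y (- z).
  by rewrite /g /kernel mulrN cosN sinN; ring.
have ig : mu.-integrable `[a, b] (EFin \o g).
  rewrite (_ : _ \o _ = (fun y => (kernel p y z)%:E + (kernel p y (- z))%:E)%E); last first.
    by apply/funext => y /=; rewrite eg EFinD.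
  exact: integrableD.
have Ig : \int[mu]_(y in `[a, b]) g y =
    \int[mu]_(y in `[a, b]) kernel p y z + \int[mu]_(y in `[a, b]) kernel p y (- z).
  rewrite -RintegralD//; apply: eq_Rintegral => y _; exact: eg.
have -> : \int[mu]_(y in `[a, b]) kernel p y z =
    \int[mu]_(y in `[a, b]) g y - \int[mu]_(y in `[a, b]) kernel p y (- z).
  by rewrite Ig addrK.
apply: le_trans (ler_normB _ _) _.
suff gb : `|\int[mu]_(y in `[a, b]) g y| <= 16 * pi.
  by apply: le_trans (lerD gb (same _ _ _ _ Npz a0 ab)) _; clear -pi0; lra.
apply: le_trans; first exact: le_normr_Rintegral ig.
(* The majorant of |g| is twice the kernel with parameter |p| at z = 0, where [same] applies as |p|
   * 0 = 0. This gives 16 pi, and 8 pi for the kernel at -z complete 24 pi. *)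
have [ik ek] := integral_kernel `|p| 0 a0 ab.
apply: (@le_trans _ _ (\int[mu]_(y in `[a, b]) (2 * kernel `|p| y 0))).
  apply: le_Rintegral => //.
  - by have := integrable_norm ig.
  - rewrite (_ : _ \o _ = (fun y : R => (2%:E * (kernel `|p| y 0)%:E)%E)); last first.
      by apply/funext => y /=; rewrite EFinM.
    exact: integrableZl.
  - move=> y /=; rewrite in_itv/= => /andP[ay _].
    have dn := den_gt0 p (lt_le_trans a0 ay).
    rewrite /g /kernel mulr0 cos0 sin0 mulr0 addr0 mulr1 real_normK ?num_real//.
    rewrite normrM ger0_norm// ler_wpM2l// normrM normfV.
    rewrite [in leLHS](gtr0_norm dn) ler_wpM2r ?invr_ge0 ?(ltW dn)//.
    by rewrite normrM ler_piMr// cos_max.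
rewrite RintegralZl//.
have := same `|p| 0 a b; rewrite mulr0 lexx => /(_ isT a0 ab).
rewrite ler_norml => /andP[_ h].
apply: (@le_trans _ _ (2 * (8 * pi))); first by rewrite ler_wpM2l.
by clear -pi0; lra.
Qed.

End KernelIntegral.

(** * Integrating the kernel against a random weight *)

Section Fubini.
Context {d1 d2 : measure_display} {T1 : measurableType d1} {T2 : measurableType d2}.
Context {R : realType}.
Context (m1 : {sigma_finite_measure set T1 -> \bar R}).
Context (m2 : {sigma_finite_measure set T2 -> \bar R}).

(** Since [D] has finite measure, the majorant a(x) is integrable over T1 x D. Fubini is applied on
    the whole product to f times the indicator of [D], and E1, E2 identify the partial integrals. *)
Lemma Rintegral_Fubini (D : set T2) (f : T1 -> T2 -> R) (a : T1 -> R) :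
  measurable D -> (m2 D < +oo)%E ->
  measurable_fun setT (fun z : T1 * T2 => f z.1 z.2) ->
  m1.-integrable setT (EFin \o a) -> (forall x, 0 <= a x) ->
  (forall x y, D y -> `|f x y| <= a x) ->
  [/\ m2.-integrable D (EFin \o (fun y => \int[m1]_x f x y)),
      m1.-integrable setT (EFin \o (fun x => \int[m2]_(y in D) f x y))
    & \int[m2]_(y in D) (\int[m1]_x f x y) =
      \int[m1]_x (\int[m2]_(y in D) f x y)].
Proof.
move=> mD Doo mf ia a0 fa.
pose g (z : T1 * T2) : \bar R := (f z.1 z.2 * \1_D z.2)%:E.
have mg : measurable_fun setT g.
  apply/measurable_EFinP; apply: measurable_funM => //.
  by apply: measurableT_comp => //; exact: measurable_indic.
have ig : (m1 \x m2)%E.-integrable setT g.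
  apply: (integrable12ltyP m1 m2 mg).2.
  apply: (@le_lt_trans _ _ (\int[m1]_x ((a x)%:E * m2 D))%E); last first.
    rewrite ge0_integralZr//.
    - have {}ia : (\int[m1]_x (a x)%:E < +oo)%E.
        case/integrableP: ia => _; apply: le_lt_trans.
        rewrite le_eqVlt; apply/orP; left; apply/eqP; apply: eq_integral => x _.
        by rewrite gee0_abs ?lee_fin.
      have fa' : (\int[m1]_x (a x)%:E)%E \is a fin_num.
        by rewrite ge0_fin_numE// integral_ge0// => x _; rewrite lee_fin.
      have fD : m2 D \is a fin_num by rewrite ge0_fin_numE.
      by rewrite -(fineK fa') -(fineK fD) -EFinM ltry.
    - exact: (measurable_int m1 ia).
    - by move=> x _; rewrite lee_fin.
  apply: ge0_le_integral => //.
  - by move=> x _; exact: integral_ge0.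
  - apply: (measurable_fun_fubini_tonelli_F (abse \o g)) => //=.
    exact: measurableT_comp.
  - by apply: emeasurable_funM => //; exact: (measurable_int m1 ia).
  move=> x _; rewrite -integral_cst// [leRHS]integral_mkcond/=.
  apply: ge0_le_integral => //.
  - have mgx : measurable_fun setT (fun y => g (x, y)) by exact: measurable_fun_pair2.
    by do 2 apply: measurableT_comp => //; move/measurable_EFinP : mgx.
  - by apply/(measurable_restrictT _ _).1 => //; exact: measurable_cst.
  move=> y _; rewrite /g /= patchE indicE; case: ifPn => yD.
    by rewrite mulr1 lee_fin fa//; exact/set_mem.
  by rewrite mulr0 normr0.
have ify y : D y -> m1.-integrable setT (EFin \o f ^~ y).
  move=> Dy; apply: le_integrable ia => //.
    by apply/measurable_EFinP; exact: (measurable_fun_pair1 y mf).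
  by move=> x _ /=; rewrite lee_fin (ger0_norm (a0 x)) fa.
have E1 y : D y -> (\int[m1]_x f x y)%:E = fubini_G m1 g y.
  move=> Dy; rewrite /fubini_G /Rintegral fineK.
    by apply: eq_integral => x _; rewrite /g /= indicE mem_set// mulr1.
  by apply: integrable_fin_num => //; exact: ify.
have E2 x : (\int[m2]_(y in D) f x y)%:E = fubini_F m2 g x.
  have mfx : measurable_fun D (f x).
    by apply: measurable_funTS; exact: (measurable_fun_pair2 x mf).
  rewrite /fubini_F /Rintegral fineK.
    rewrite integral_mkcond; apply: eq_integral => y _.
    by rewrite /g /= patchE indicE; case: ifP => _; rewrite ?mulr1 ?mulr0.
  apply: integrable_fin_num => //; apply/integrableP; split.
    exact/measurable_EFinP.
  apply: (@le_lt_trans _ _ (\int[m2]_(y in D) (a x)%:E)%E).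
    apply: ge0_le_integral => //.
    - by apply: measurableT_comp => //; exact/measurable_EFinP.
    - by move=> y Dy; rewrite lee_fin fa.
  rewrite integral_cst//.
  by apply: lte_mul_pinfty => //; rewrite lee_fin.
have iF := integrable_fubini_F ig.
split.
- apply: (eq_integrable mD (fubini_G m1 g)).
    by move=> y yD /=; rewrite E1//; exact/set_mem.
  apply: (@le_integrable _ _ _ _ _ _ _ (EFin \o (fun=> \int[m1]_x a x))) => //.
  - by apply: measurable_funTS; exact: (measurable_fubini_G ig).
  - move=> y Dy; rewrite -E1//= lee_fin.
    rewrite [leRHS]ger0_norm; last by apply: Rintegral_ge0 => x _; exact: a0.
    apply: le_trans; first exact: le_normr_Rintegral (ify y Dy).
    by apply: le_Rintegral => //; [exact: integrable_norm (ify y Dy)|move=> x _; exact: fa].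
  - apply/integrableP; split; first exact: measurable_cst.
    by rewrite integral_cst//; apply: lte_mul_pinfty => //=; rewrite lee_fin.
- apply: (eq_integrable measurableT (fubini_F m2 g)) => // x _ /=.
  by rewrite E2.
- rewrite /Rintegral [in RHS](eq_integral (fubini_F m2 g)); last first.
    by move=> x _; rewrite -E2.
  rewrite integral12_prod_meas1// -integral21_prod_meas1// integral_mkcond.
  congr fine; apply: eq_integral => y _; rewrite patchE.
  case: ifPn => yD; first by rewrite -E1//; exact/set_mem.
  rewrite /fubini_G integral0_eq// => x _.
  by rewrite /g /= indicE (negbTE yD) mulr0.
Qed.
End Fubini.

Section Inversion.
Context {R : realType}.
Notation mu := (@lebesgue_measure R).

Lemma measurable_inv : measurable_fun setT (fun x : R => x^-1).
Proof.
rewrite -(setUv [set (0 : R)]).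
apply/measurable_funU => //; first exact: measurableC.
split; first exact: measurable_fun_set1.
apply: open_continuous_measurable_fun.
  rewrite (_ : ~` _ = [set x | x != 0]); first exact: open_neq.
  by apply/seteqP; split => x /eqP.
by move=> x; rewrite inE => /eqP x0; apply: cvgV => //; exact: cvg_id.
Qed.

Context {d : measure_display} {T : measurableType d} (P : probability T R).

Lemma measurable_kernel (p : R) (m Z : T -> R) :
  measurable_fun setT m -> measurable_fun setT Z ->
  measurable_fun setT (fun z : T * R => m z.1 * kernel p z.2 (Z z.1)).
Proof.
move=> mm mZ.
have m1 : measurable_fun setT (fun z : T * R => m z.1).
  by apply: (measurableT_comp mm); exact: measurable_fst.
have mZ1 : measurable_fun setT (fun z : T * R => Z z.1).
  by apply: (measurableT_comp mZ); exact: measurable_fst.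
have m2 : measurable_fun setT (fun z : T * R => z.2) by exact: measurable_snd.
have mc : measurable_fun setT (@cos R).
  by apply: continuous_measurable_fun; exact: continuous_cos.
have ms : measurable_fun setT (@sin R).
  by apply: continuous_measurable_fun; exact: continuous_sin.
have m2Z : measurable_fun setT (fun z : T * R => z.2 * Z z.1) by exact: measurable_funM.
apply: measurable_funM => //; apply: measurable_funM.
  apply: measurable_funD; apply: measurable_funM => //.
    exact: (measurableT_comp mc m2Z).
  exact: (measurableT_comp ms m2Z).
apply: (measurableT_comp measurable_inv).
by apply: measurable_funD => //; exact: measurable_funX.
Qed.

(** Only for Fubini on a fixed [a, b]: the bound is free of z but explodes as a tends to 0. *)
Lemma kernel_bound (p y z a b : R) : 0 < a -> a <= y <= b ->
  `|kernel p y z| <= (`|p| + b) / a ^+ 2.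
Proof.
move=> a0 /andP[ay yb]; have y0 := lt_le_trans a0 ay.
rewrite /kernel normrM normfV (gtr0_norm (den_gt0 p y0)).
apply: ler_pM => //; first by rewrite invr_ge0 ltW// den_gt0.
  apply: le_trans (ler_normD _ _) _; apply: lerD; rewrite normrM.
    by rewrite ler_piMr// cos_max.
  rewrite (gtr0_norm y0); apply: le_trans yb.
  by rewrite ler_piMr ?sin_max ?(ltW y0).
rewrite lef_pV2 ?posrE ?den_gt0 ?exprn_gt0//.
by rewrite ler_wpDl ?sqr_ge0// lerXn2r ?nnegrE ?(ltW a0) ?(ltW y0).
Qed.

(** The primitive at y is its increment from a, bounded uniformly, plus its value at a, which is
    arbitrarily small as a tends to 0. *)
Lemma kernel_primitive_bound (p z y : R) : 0 < y ->
  `|kernel_primitive p z y| <= 24 * pi.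
Proof.
move=> y0; apply/ler_addgt0Pr => e e0.
have := @kernel_primitive_cvg0 R p z => /cvgrPdist_le/(_ e e0) H.
near (0 : R)^'+ => a.
have a0 : 0 < a by near: a; exact: nbhs_right_gt.
have ay : a <= y by near: a; exact: nbhs_right_le.
have : `|0 - kernel_primitive p z a| <= e by near: a; exact: H.
rewrite sub0r normrN => ae.
have := integral_kernel_bound p z a0 ay; rewrite (integral_kernel p z a0 ay).2 => h.
rewrite -(subrK (kernel_primitive p z a) (kernel_primitive p z y)).
by apply: le_trans (ler_normD _ _) _; apply: lerD.
Unshelve. all: by end_near. Qed.

Section Weighted.
Variables (p : R) (m Z : T -> R).
Hypotheses (mm : measurable_fun setT m) (mZ : measurable_fun setT Z).
Hypothesis im : P.-integrable setT (EFin \o m).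

Lemma kernel_Fubini (a b : R) : 0 < a -> a <= b ->
  [/\ mu.-integrable `[a, b] (EFin \o (fun y => \int[P]_w (m w * kernel p y (Z w)))),
      P.-integrable setT (EFin \o (fun w =>
        m w * (kernel_primitive p (Z w) b - kernel_primitive p (Z w) a)))
    & \int[mu]_(y in `[a, b]) (\int[P]_w (m w * kernel p y (Z w))) =
      \int[P]_w (m w * (kernel_primitive p (Z w) b - kernel_primitive p (Z w) a))].
Proof.
move=> a0 ab.
have b0 := lt_le_trans a0 ab.
have c0 : 0 <= (`|p| + b) / a ^+ 2 by rewrite divr_ge0 ?addr_ge0 ?sqr_ge0 ?(ltW b0).
have [] := @Rintegral_Fubini _ _ T (measurableTypeR R) R P mu `[a, b]%classic
  (fun w y => m w * kernel p y (Z w)) (fun w => `|m w| * ((`|p| + b) / a ^+ 2)).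
- exact: measurable_itv.
- rewrite /= lebesgue_measure_itv/=; case: ifP => _; last by rewrite ltry.
  by rewrite -EFinB ltry.
- exact: measurable_kernel.
- rewrite (_ : _ \o _ = (fun w => (`|m w|)%:E * ((`|p| + b) / a ^+ 2)%:E)%E); last first.
    by apply/funext => w /=; rewrite EFinM.
  by apply: integrableZr => //; have := integrable_norm im.
- by move=> w; rewrite mulr_ge0.
- move=> w y /=; rewrite in_itv/= => yab; rewrite normrM ler_wpM2l//.
  exact: kernel_bound.
have E w : \int[mu]_(y in `[a, b]) (m w * kernel p y (Z w)) =
    m w * (kernel_primitive p (Z w) b - kernel_primitive p (Z w) a).
  have [ik ek] := integral_kernel p (Z w) a0 ab.
  by rewrite RintegralZl// ek.
move=> i1 i2 e; split => //.
  by rewrite (_ : _ \o _ = EFin \o (fun w => \int[mu]_(y in `[a, b]) (m w * kernel p y (Z w))))//;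
    apply/funext => w /=; rewrite E.
by rewrite e; apply: eq_Rintegral => w _; exact: E.
Qed.

Let bound_integrable : P.-integrable setT (EFin \o (fun w => `|m w| * (24 * pi))).
Proof.
rewrite (_ : _ \o _ = (fun w => (`|m w|)%:E * (24 * pi)%:E)%E); last first.
  by apply/funext => w /=; rewrite EFinM.
by apply: integrableZr => //; have := integrable_norm im.
Qed.

Lemma weighted_kernel_cvg0 (N : R) : 0 < N ->
  P.-integrable setT (EFin \o (fun w => m w * kernel_primitive p (Z w) N)) /\
  \int[mu]_(y in `[a, N]) (\int[P]_w (m w * kernel p y (Z w))) @[a --> 0^'+]
    --> \int[P]_w (m w * kernel_primitive p (Z w) N).
Proof.
move=> N0.
(* The minimum keeps the interval nonempty for every a > 0, as the domination is required for all
   such a; near 0 it equals a. *)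
pose J a w := m w * (kernel_primitive p (Z w) N - kernel_primitive p (Z w) (Num.min a N)).
have min0 a : 0 < a -> 0 < Num.min a N by move=> a0; rewrite lt_min a0.
have minN (a : R) : Num.min a N <= N by rewrite ge_min lexx orbT.
have [] := @Rintegral_dominated_cvg_at_right R _ T P setT measurableT J
  (fun w => m w * kernel_primitive p (Z w) N) (fun w => `|m w| * (24 * pi)) 0.
- move=> a a0; have [_ i _] := kernel_Fubini (min0 a a0) (minN a).
  by move/(measurable_int P)/measurable_EFinP: i.
- move=> w _; apply: cvgMl_tmp.
  rewrite -[X in _ --> X]subr0; apply: cvgB; first exact: cvg_cst.
  have := @kernel_primitive_cvg0 R p (Z w); apply: cvg_trans.
  apply: near_eq_cvg; near=> a; rewrite min_l//.
  by near: a; exact: nbhs_right_le.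
- exact: bound_integrable.
- move=> a w a0 _; rewrite /J normrM ler_wpM2l//.
  have [_ <-] := integral_kernel p (Z w) (min0 a a0) (minN a).
  exact: (integral_kernel_bound p (Z w) (min0 a a0) (minN a)).
move=> i c; split => //; apply: cvg_trans c; apply: near_eq_cvg.
near=> a.
have a0 : 0 < a by near: a; exact: nbhs_right_gt.
have aN : a <= N by near: a; exact: nbhs_right_le.
by have [_ _ ->] := kernel_Fubini a0 aN; rewrite /J min_l.
Unshelve. all: by end_near. Qed.

Lemma improper_integral_kernel :
  P.-integrable setT (EFin \o (fun w => m w * kernel_limit p (Z w))) /\
  improper_integral (fun y => \int[P]_w (m w * kernel p y (Z w)))
    (pi * \int[P]_w (m w * kernel_limit p (Z w))).
Proof.
have pi_gt0 := @pi_gt0 R.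
have [] := @Rintegral_dominated_cvg_pinfty R _ T P setT measurableT
  (fun N w => m w * kernel_primitive p (Z w) N)
  (fun w => m w * (pi * kernel_limit p (Z w))) (fun w => `|m w| * (24 * pi)) 0.
- move=> N N0; have [i _] := weighted_kernel_cvg0 N0.
  by move/(measurable_int P)/measurable_EFinP: i.
- by move=> w _; apply: cvgMl_tmp; exact: kernel_primitive_cvgy.
- exact: bound_integrable.
- by move=> N w N0 _; rewrite normrM ler_wpM2l// kernel_primitive_bound.
move=> i c.
have i' : P.-integrable setT (EFin \o (fun w => m w * kernel_limit p (Z w))).
  rewrite (_ : _ \o _ = (fun w => (pi^-1)%:E * (m w * (pi * kernel_limit p (Z w)))%:E)%E).
    by apply: integrableZl.
  apply/funext => w /=; rewrite -EFinM; congr (_%:E).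
  by rewrite [in RHS]mulrCA [in RHS]mulKf ?gt_eqF.
split => //.
(* The lower endpoint leaves no trace in this inner limit, the primitive being 0 at 0+. *)
exists (fun N => \int[P]_w (m w * kernel_primitive p (Z w) N)); split.
- move=> a N a0; have [aN|Na] := leP a N.
    by have [] := kernel_Fubini a0 aN.
  rewrite set_itv_ge; last by rewrite -leNgt bnd_simp.
  exact: integrable_set0.
- by move=> N N0; have [] := weighted_kernel_cvg0 N0.
- rewrite -RintegralZl//.
  rewrite (@eq_Rintegral _ _ _ P _ (fun w => m w * (pi * kernel_limit p (Z w)))) //.
  by move=> w _; ring.
Qed.

End Weighted.
End Inversion.

(** * Inversion formulas for prices *)

(** With h = h^+ - h^-, the identity f + h^- = g + h^+ has only nonnegative terms, so it integrates
    even when f and g have infinite integrals; the finite integral of h^- is then subtracted. *)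
Lemma integral_ge0D_integrable (d : measure_display) (T : measurableType d)
    (R : realType) (mu : {measure set T -> \bar R}) (f g h : T -> R) :
  measurable_fun setT f -> measurable_fun setT g ->
  (forall x, 0 <= f x) -> (forall x, 0 <= g x) ->
  mu.-integrable setT (EFin \o h) -> (forall x, f x = g x + h x) ->
  (\int[mu]_x (f x)%:E = \int[mu]_x (g x)%:E + (\int[mu]_x h x)%:E)%E.
Proof.
move=> mf mg f0 g0 ih fgh.
have mh : measurable_fun setT h by move/(measurable_int mu)/measurable_EFinP: ih.
have mp : measurable_fun setT (fun x => Num.max (h x) 0) by exact: measurable_maxr.
have mn : measurable_fun setT (fun x => Num.max (- h x) 0).
  by apply: measurable_maxr => //; exact: measurableT_comp.
have ip : mu.-integrable setT (EFin \o (fun x => Num.max (h x) 0)).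
  apply: le_integrable ih => //; first exact/measurable_EFinP.
  move=> x _ /=; rewrite lee_fin ger0_norm ?le_max ?lexx ?orbT//.
  by rewrite ge_max ler_norm normr_ge0.
have iN : mu.-integrable setT (EFin \o (fun x => Num.max (- h x) 0)).
  apply: le_integrable ih => //; first exact/measurable_EFinP.
  move=> x _ /=; rewrite lee_fin ger0_norm ?le_max ?lexx ?orbT//.
  by rewrite ge_max -normrN ler_norm normr_ge0.
have hpn x : h x = Num.max (h x) 0 - Num.max (- h x) 0.
  have /orP[h0|h0] := le_total 0 (h x).
    by rewrite max_l// max_r ?oppr_le0// subr0.
  by rewrite max_r// max_l ?oppr_ge0// sub0r opprK.
have E : (\int[mu]_x (f x)%:E + \int[mu]_x (Num.max (- h x) 0)%:E =
          \int[mu]_x (g x)%:E + \int[mu]_x (Num.max (h x) 0)%:E)%E.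
  rewrite -!ge0_integralD//=; do ?[exact/measurable_EFinP|by move=> x _; rewrite lee_fin ?f0 ?g0 ?le_max ?lexx ?orbT].
  by apply: eq_integral => x _; rewrite -!EFinD fgh {1}hpn; congr EFin; ring.
have -> : (\int[mu]_x h x)%:E =
    (\int[mu]_x (Num.max (h x) 0)%:E - \int[mu]_x (Num.max (- h x) 0)%:E)%E.
  rewrite -integralB_EFin// /Rintegral fineK; last exact: integrable_fin_num.
  by apply: eq_integral => x _; rewrite -EFinB -hpn.
by rewrite addeA -E addeK//; exact: integrable_fin_num.
Qed.

(** Agreement for y > 0 is enough, which avoids y = 0, where the transforms may have a vanishing
    denominator. *)
Lemma improper_integral_ext (R : realType) (f g : R -> R) (l : R) :
  (forall y, 0 < y -> f y = g y) -> improper_integral f l -> improper_integral g l.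
Proof.
move=> fg [F [i c0 cy]]; exists F; split => // [a N a0|N N0].
  apply: eq_integrable (i a N a0) => // y; rewrite inE/= in_itv/= => /andP[ay _].
  by rewrite fg// (lt_le_trans a0).
apply: cvg_trans (c0 N N0); apply: near_eq_cvg; near=> a.
apply: eq_Rintegral => y; rewrite inE/= in_itv/= => /andP[ay _].
by rewrite fg// (lt_le_trans _ ay).
Unshelve. all: by end_near. Qed.

Lemma improper_integralB (R : realType) (f g : R -> R) (k l : R) :
  improper_integral f k -> improper_integral g l ->
  improper_integral (fun y => f y - g y) (k - l).
Proof.
move=> [F [fi f0 fy]] [G [gi g0 gy]]; exists (fun N => F N - G N); split.
- move=> a N a0; rewrite (_ : _ \o _ = (fun y => (f y)%:E - (g y)%:E)%E)//.
  by apply: integrableB => //; [exact: fi|exact: gi].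
- move=> N N0; apply: cvg_trans (cvgB (f0 N N0) (g0 N N0)).
  apply: near_eq_cvg; near=> a.
  have a0 : 0 < a by near: a; exact: nbhs_right_gt.
  by rewrite /= RintegralB//; [exact: fi|exact: gi].
- exact: cvgB.
Unshelve. all: by end_near. Qed.

Section PriceInversion.
Context {R : realType} {d : measure_display} {T : measurableType d}.
Context (P : probability T R) (rho Y : T -> R).
Hypotheses (mrho : measurable_fun setT rho) (mY : measurable_fun setT Y).
Hypotheses (rho_ge0 : forall w, 0 <= rho w) (rho_le1 : forall w, rho w <= 1).

(** The integrand of the discounted moment of order r: [rho] stands for the discount factor killed
    at default, [Y] for the exponent of the stock price. *)
Definition weight (r : R) (w : T) : R := rho w * expR (r * Y w).

Lemma measurable_weight r : measurable_fun setT (weight r).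
Proof.
apply: measurable_funM => //; apply: measurableT_comp => //.
exact: measurable_funM.
Qed.

Lemma weight_ge0 r w : 0 <= weight r w.
Proof. by rewrite mulr_ge0 ?expR_ge0. Qed.

Lemma integrable_weight r : (\int[P]_w (weight r w)%:E < +oo)%E ->
  P.-integrable setT (EFin \o weight r).
Proof.
move=> h; apply: ge0_integrable => //; first exact: measurable_weight.
by move=> w _; exact: weight_ge0.
Qed.

(** The factor e^(-pZ) of the limit lowers the order of the moment from r to r - p; hence the orders
    1 and 0 in the residues. A separate q is kept for the call, where e^(-pk) also multiplies the
    kernel of parameter p + 1 and e^k is left over. *)
Lemma weight_kernel_limit (r p q k : R) (w : T) :
  expR (- q * k) * (weight r w * kernel_limit p (Y w - k)) =
  expR ((p - q) * k) * weight (r - p) w * (Num.sg p + Num.sg (Y w - k)) / 2.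
Proof.
rewrite /weight /kernel_limit.
have -> : expR ((r - p) * Y w) = expR (r * Y w) * expR (- (p * Y w)).
  by rewrite -expRD; congr expR; ring.
have -> : expR (- (p * (Y w - k))) = expR (p * k) * expR (- (p * Y w)).
  by rewrite -expRD; congr expR; ring.
have -> : expR ((p - q) * k) = expR (p * k) * expR (- q * k).
  by rewrite -expRD; congr expR; ring.
by field.
Qed.

(** Off Z = 0 the indicator of Z > 0 is (1 + sgn Z) / 2 = (1 - sgn p) / 2 + (sgn p + sgn Z) / 2. The
    constant part yields the residue, the other one the inversion integral. *)
Lemma digital_inversion (r p k : R) (v : T -> R) (g : R -> R[i]) :
  (\int[P]_w (weight r w)%:E < +oo)%E ->
  P [set w | rho w != 0 /\ Y w = k] = 0%E ->
  (forall w, v w = weight (r - p) w * (k < Y w)%R%:R) ->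
  (forall y, 0 < y -> complex.Re (cexp (0 -i* (y * k)) * g y) =
     \int[P]_w (weight r w * kernel p y (Y w - k))) ->
  inversion_formula (\int[P]_w (v w)%:E)
    (if (p < 0)%R then \int[P]_w (weight (r - p) w)%:E
     else if (p == 0)%R then (2^-1)%:E * \int[P]_w (weight (r - p) w)%:E
     else 0)%E p k g.
Proof.
move=> fr null vE gE.
have mZ : measurable_fun setT (fun w => Y w - k) by exact: measurable_funB.
have [ik Ik] := improper_integral_kernel p (measurable_weight r) mZ (integrable_weight fr).
exists (pi * \int[P]_w (weight r w * kernel_limit p (Y w - k))).
  apply: improper_integral_ext Ik => y y0; rewrite gE//.
have pi0 : pi != 0 :> R by rewrite gt_eqF// pi_gt0.
have -> : expR (- p * k) / pi * (pi * \int[P]_w (weight r w * kernel_limit p (Y w - k))) =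
    \int[P]_w (expR (- p * k) * (weight r w * kernel_limit p (Y w - k))).
  by rewrite (RintegralZl _ measurableT ik) mulrA divfK.
have msg : measurable_fun setT (fun w => Num.sg (Y w - k)).
  rewrite (_ : (fun _ => _) = (fun w => if 0 < Y w - k then 1 else if Y w - k < 0 then -1 else 0)).
    apply: measurable_fun_ifT => //; first exact: measurable_fun_ltr.
    by apply: measurable_fun_ifT => //; exact: measurable_fun_ltr.
  by apply/funext => w; case: sgrP.
have sgb w : -1 <= Num.sg (Y w - k) <= 1.
  by have [_|_|_] := sgrP (Y w - k); rewrite ?lexx ?lerN10 ?ler01 ?ler0N1//; lra.
(* The payoff with half its weight at Y = k, which is what the integral represents; it agrees with
   [v] off the null set. *)
pose f w := weight (r - p) w * ((1 + Num.sg (Y w - k)) / 2).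
have mf : measurable_fun setT f.
  apply: measurable_funM; first exact: measurable_weight.
  by apply: measurable_funM => //; exact: measurable_funD.
have -> : (\int[P]_w (v w)%:E = \int[P]_w (f w)%:E)%E.
  apply: ae_eq_integral => //.
  - apply/measurable_EFinP.
    rewrite (_ : v = (fun w => if k < Y w then weight (r - p) w else 0)).
      apply: measurable_fun_ifT => //; first exact: measurable_fun_ltr.
      exact: measurable_weight.
    by apply/funext => w; rewrite vE; case: ifP; rewrite ?mulr1 ?mulr0.
  - exact/measurable_EFinP.
  exists [set w | rho w != 0 /\ Y w = k]; split => //.
    rewrite (_ : [set w | _] = (rho @^-1` ~` [set 0]) `&` (Y @^-1` [set k])).
      apply: measurableI; rewrite -[X in measurable X]setTI.
        by apply: mrho => //; exact: measurableC.
      exact: mY.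
    by apply/seteqP; split => w /= [/eqP ? ?].
  move=> w /=; apply: contra_notP => nw _; congr EFin; rewrite vE /f.
  have [r0|r0] := eqVneq (rho w) 0; first by rewrite /weight r0 !mul0r.
  congr (_ * _); have [Yk|Yk|Yk] := ltgtP k (Y w).
  - by rewrite gtr0_sg ?subr_gt0// divff.
  - by rewrite ltr0_sg ?subr_lt0// subrr mul0r.
  - by exfalso; apply: nw.
rewrite (@integral_ge0D_integrable _ _ _ P f
  (fun w => (1 - Num.sg p) / 2 * weight (r - p) w)
  (fun w => expR (- p * k) * (weight r w * kernel_limit p (Y w - k)))) //.
- congr (_ + _)%E; under [LHS]eq_integral do rewrite EFinM.
  rewrite ge0_integralZl//.
  + have [p0|p0|->] := ltgtP p 0.
    * by rewrite ltr0_sg// opprK -mulr2n divff// mul1e.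
    * by rewrite gtr0_sg// subrr mul0r mul0e.
    * by rewrite sgr0 subr0 mul1r.
  + by apply/measurable_EFinP; exact: measurable_weight.
  + by move=> w _; rewrite lee_fin weight_ge0.
  + by rewrite lee_fin; have [_|_|_] := sgrP p; lra.
- by apply: measurable_funM => //; exact: measurable_weight.
- by move=> w; rewrite mulr_ge0 ?weight_ge0//; have := sgb w; lra.
- by move=> w; rewrite mulr_ge0 ?weight_ge0//; have [_|_|_] := sgrP p; lra.
- rewrite (_ : _ \o _ = (fun w => (expR (- p * k))%:E * (weight r w * kernel_limit p (Y w - k))%:E)%E)//.
  exact: integrableZl.
- move=> w; rewrite weight_kernel_limit /f subrr mul0r expR0 mul1r.
  by field.
Qed.

(* [weight 1] may fail to be integrable when [p < 0]; the identity then holds in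
   [\bar R] because the difference with the price stays integrable. *)
Lemma call_inversion (p k : R) (v : T -> R) (g : R -> R[i]) :
  (\int[P]_w (weight (p + 1) w)%:E < +oo)%E ->
  (forall w, v w = rho w * Num.max (expR (Y w) - expR k) 0) ->
  (forall y, 0 < y -> complex.Re (cexp (0 -i* (y * k)) * g y) =
     \int[P]_w (weight (p + 1) w * kernel p y (Y w - k)) -
     \int[P]_w (weight (p + 1) w * kernel (p + 1) y (Y w - k))) ->
  inversion_formula (\int[P]_w (v w)%:E)
    (if (p < -1)%R then \int[P]_w (weight 1 w)%:E - (expR k)%:E * \int[P]_w (weight 0 w)%:E
     else if (p == -1)%R then \int[P]_w (weight 1 w)%:E - (2^-1 * expR k)%:E * \int[P]_w (weight 0 w)%:E
     else if (p < 0)%R then \int[P]_w (weight 1 w)%:E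
     else if (p == 0)%R then (2^-1)%:E * \int[P]_w (weight 1 w)%:E
     else 0)%E p k g.
Proof.
move=> fr vE gE.
have mZ : measurable_fun setT (fun w => Y w - k) by exact: measurable_funB.
have iw := integrable_weight fr.
have [ik Ik] := improper_integral_kernel p (measurable_weight _) mZ iw.
have [ik1 Ik1] := improper_integral_kernel (p + 1) (measurable_weight _) mZ iw.
have pi0 : pi != 0 :> R by rewrite gt_eqF// pi_gt0.
pose phi w := expR (- p * k) * (weight (p + 1) w * kernel_limit p (Y w - k))
  - expR (- p * k) * (weight (p + 1) w * kernel_limit (p + 1) (Y w - k)).
exists (pi * \int[P]_w (weight (p + 1) w * kernel_limit p (Y w - k)) -
        pi * \int[P]_w (weight (p + 1) w * kernel_limit (p + 1) (Y w - k))).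
  by apply: improper_integral_ext (improper_integralB Ik Ik1) => y y0; rewrite gE.
have i1 : P.-integrable setT (EFin \o (fun w => expR (- p * k) * (weight (p + 1) w * kernel_limit p (Y w - k)))).
  rewrite (_ : _ \o _ = (fun w => (expR (- p * k))%:E * (weight (p + 1) w * kernel_limit p (Y w - k))%:E)%E)//.
  exact: integrableZl.
have i2 : P.-integrable setT (EFin \o (fun w => expR (- p * k) * (weight (p + 1) w * kernel_limit (p + 1) (Y w - k)))).
  rewrite (_ : _ \o _ = (fun w => (expR (- p * k))%:E * (weight (p + 1) w * kernel_limit (p + 1) (Y w - k))%:E)%E)//.
  exact: integrableZl.
have iphi : P.-integrable setT (EFin \o phi).
  rewrite (_ : _ \o _ = (fun w => (expR (- p * k) * (weight (p + 1) w * kernel_limit p (Y w - k)))%:E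
     - (expR (- p * k) * (weight (p + 1) w * kernel_limit (p + 1) (Y w - k)))%:E)%E)//.
  exact: integrableB.
have -> : expR (- p * k) / pi *
     (pi * \int[P]_w (weight (p + 1) w * kernel_limit p (Y w - k)) -
        pi * \int[P]_w (weight (p + 1) w * kernel_limit (p + 1) (Y w - k))) =
     \int[P]_w phi w.
  rewrite (RintegralB measurableT i1 i2) (RintegralZl _ measurableT ik).
  by rewrite (RintegralZl _ measurableT ik1) -!mulrBr mulrA divfK.
(* [weight 0] is [rho], at most 1, so its term can join the integrable part; [weight 1] has to stay
   in [\bar R]. *)
have i0 : P.-integrable setT (EFin \o weight 0).
  apply: (@le_integrable _ _ _ _ _ _ _ (EFin \o (fun=> 1))) => //.
  - by apply/measurable_EFinP; exact: measurable_weight.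
  - move=> w _ /=; rewrite lee_fin ger0_norm ?weight_ge0//.
    by rewrite /weight mul0r expR0 mulr1 normr1.
  - exact: (finite_measure_integrable_cst P 1 measurableT).
(* The residue coefficients of the poles at p = -1 and p = 0: each is 1, 1/2 or 0 according to the
   sign. *)
pose al : R := (1 - Num.sg (p + 1)) / 2.
pose be : R := (1 - Num.sg p) / 2.
have ial : P.-integrable setT (EFin \o (fun w => (expR k * al) * weight 0 w)).
  rewrite (_ : _ \o _ = (fun w => (expR k * al)%:E * (weight 0 w)%:E)%E)//.
  exact: integrableZl.
have mv : measurable_fun setT v.
  rewrite (_ : v = (fun w => rho w * Num.max (expR (Y w) - expR k) 0)); last exact/funext.
  apply: measurable_funM => //; apply: measurable_maxr => //.
  by apply: measurable_funB => //; exact: measurableT_comp.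
have -> : (\int[P]_w (v w)%:E = be%:E * \int[P]_w (weight 1 w)%:E +
     (\int[P]_w phi w - expR k * al * \int[P]_w weight 0 w)%:E)%E.
  rewrite (@integral_ge0D_integrable _ _ _ P v (fun w => be * weight 1 w)
     (fun w => phi w - expR k * al * weight 0 w)) //.
  - under eq_integral do rewrite EFinM.
    rewrite ge0_integralZl//.
    + by rewrite RintegralB// RintegralZl.
    + by apply/measurable_EFinP; exact: measurable_weight.
    + by move=> w _; rewrite lee_fin weight_ge0.
    + by rewrite lee_fin /be; have [_|_|_] := sgrP p; lra.
  - by apply: measurable_funM => //; exact: measurable_weight.
  - by move=> w; rewrite vE mulr_ge0// le_max lexx orbT.
  - by move=> w; rewrite mulr_ge0 ?weight_ge0// /be; have [_|_|_] := sgrP p; lra.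
  - rewrite (_ : _ \o _ = (fun w => (phi w)%:E - (expR k * al * weight 0 w)%:E)%E)//.
    exact: integrableB.
  - move=> w; rewrite /phi (weight_kernel_limit (p + 1) p p k w).
    rewrite (weight_kernel_limit (p + 1) (p + 1) p k w) vE.
    have -> : p + 1 - p = 1 by ring.
    rewrite !subrr mul0r expR0 !mul1r /weight mul0r expR0 mulr1 mul1r /al /be.
    have [Yk|Yk|Yk] := ltgtP (Y w) k.
    + rewrite max_r; last by rewrite subr_le0 ler_expR ltW.
      by rewrite (@ltr0_sg _ (Y w - k)) ?subr_lt0//; field.
    + rewrite max_l; last by rewrite subr_ge0 ler_expR ltW.
      by rewrite (@gtr0_sg _ (Y w - k)) ?subr_gt0//; field.
    (* At Y = k the jumps of the two kernel limits have the same size and cancel, so an atom at the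
       strike leaves the identity exact. *)
    + by rewrite Yk !subrr maxxx sgr0; field.
have -> : (\int[P]_w (weight 0 w)%:E = (\int[P]_w weight 0 w)%:E)%E.
  by rewrite /Rintegral fineK//; exact: integrable_fin_num.
have sumE (M : \bar R) (I J : R) : (M + (I - J)%:E = M - J%:E + I%:E)%E.
  by rewrite EFinB -[RHS]addeA; congr (_ + _)%E; rewrite addeC.
rewrite sumE /al /be; congr (_ + _)%E.
have h1 : (1 - -1) / 2 = 1 :> R by field.
have [p1|p1|->] := ltgtP p (-1).
- by rewrite !ltr0_sg ?h1 ?mul1e ?mulr1 ?EFinM//; lra.
- rewrite (@gtr0_sg _ (p + 1)); last lra.
  rewrite subrr mul0r mulr0 mul0r sube0.
  have [p0|p0|->] := ltgtP p 0.
  + by rewrite ltr0_sg// h1 mul1e.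
  + by rewrite gtr0_sg// subrr mul0r mul0e.
  + by rewrite sgr0 subr0 mul1r.
- rewrite addNr sgr0 sgrN sgr1 h1 mul1e subr0 mul1r.
  by rewrite (mulrC (expR k)) EFinM.
Qed.

End PriceInversion.

(** * Integrals along right-continuous paths *)

Section PathIntegral.
Context {R : realType} {d : measure_display} {T : measurableType d}.
Notation mu := (@lebesgue_measure R).
Variable f : R -> T -> R.
Hypothesis mf : forall u : R, 0 <= u -> measurable_fun setT (f u).
Hypothesis f_right : forall w (u : R), 0 <= u -> f s w @[s --> u^'+] --> f u w.
Hypothesis f_left : forall w (u : R), 0 < u -> exists l : R, f s w @[s --> u^'-] --> l.
Hypothesis f_ge0 : forall w (u : R), 0 <= u -> 0 <= f u w.

Definition path_integral (t : R) (w : T) : R := \int[mu]_(u in `[0, t]) f u w.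

(** To the right of u the path is close to its value at u, to the left close to its left limit; at u
    = 0 there is no left side. *)
Lemma path_locally_bounded w (u : R) : 0 <= u ->
  exists M, \forall y \near u, 0 <= y -> `|f y w| <= M.
Proof.
move=> u0.
have right : \forall y \near u, u < y -> `|f y w| <= `|f u w| + 1.
  have /cvgrPdist_le/(_ 1 ltr01) := @f_right w _ u0.
  rewrite /at_right near_withinE; apply: filterS => y h uy.
  rewrite -[f y w](subrK (f u w)) addrC; apply: le_trans (ler_normD _ _) _.
  by rewrite lerD2l distrC h.
have [M left] : exists M, \forall y \near u, 0 <= y -> y < u -> `|f y w| <= M.
  move: u0; rewrite le_eqVlt => /predU1P[<-|u0].
    by exists 0; near=> y => y0; rewrite ltNge y0.
  have [l /cvgrPdist_le/(_ 1 ltr01)] := @f_left w u u0.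
  move=> H; exists (`|l| + 1); move: H; rewrite /at_left near_withinE; apply: filterS => y h _ uy.
  rewrite -[f y w](subrK l) addrC; apply: le_trans (ler_normD _ _) _.
  by rewrite lerD2l distrC h.
exists (Num.max M (`|f u w| + 1)); near=> y => y0.
have hl : 0 <= y -> y < u -> `|f y w| <= M by near: y; exact: left.
have hr : u < y -> `|f y w| <= `|f u w| + 1 by near: y; exact: right.
rewrite le_max; have [yu|uy|->] := ltgtP y u.
- by rewrite hl.
- by rewrite hr ?orbT.
- by rewrite lerDl ler01 orbT.
Unshelve. all: by end_near. Qed.

(** Compactness of [0, t] turns the local bounds into a single one. *)
Lemma path_bounded w (t : R) : exists M, forall u, 0 <= u <= t -> `|f u w| <= M.
Proof.
have /compact_near_coveringP/near_covering_withinP := @segment_compact R 0 t.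
move=> /(_ R (pinfty_nbhs R) (fun M y => `|f y w| <= M) _) H.
have : \forall M \near (pinfty_nbhs R), `[0, t]%classic `<=` (fun y => `|f y w| <= M).
  apply: H => u /=; rewrite in_itv/= => /andP[u0 _].
  have [M hM] := path_locally_bounded w u0.
  near=> y N => /=; rewrite in_itv/= => /andP[y0 _].
  have hy : 0 <= y -> `|f y w| <= M by near: y; exact: hM.
  apply: (le_trans (hy y0)).
  by near: N; apply: nbhs_pinfty_ge; exact: num_real.
move=> /filter_ex [M hM]; exists M => u u0t.
by apply: hM; rewrite /= in_itv.
Unshelve. all: by end_near. Qed.

(** The first point of the grid of mesh 1 / (n + 1) strictly to the right of u^+; the successor
    makes it strict, as a limit from the right demands. *)
Let q (n : nat) (u : R) : R := (Num.truncn (Num.max u 0 * n.+1%:R)).+1%:R / n.+1%:R.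

Lemma q_gt n u : Num.max u 0 < q n u <= Num.max u 0 + n.+1%:R^-1.
Proof.
have u0 : 0 <= Num.max u 0 * n.+1%:R by rewrite mulr_ge0// le_max lexx orbT.
have /andP[h1 h2] := truncn_itv u0.
rewrite /q ltr_pdivlMr// h2/= ler_pdivrMr// mulrDl mulVf// -natr1 lerD2r//.
Qed.

(** By right-continuity the path is the limit of its values at the grid times [q n u], and these are
    constant in time on each grid cell. The maximum with 0 keeps to the times where the hypotheses
    on [f] apply. *)
Lemma measurable_path_joint :
  measurable_fun setT (fun z : R * T => f (Num.max z.1 0) z.2).
Proof.
apply: (@measurable_fun_cvg _ _ _ _ (fun n (z : R * T) => f (q n z.1) z.2)).
  move=> n _ B mB; rewrite setTI.
  (* On the j-th cell time is frozen at (j + 1) / (n + 1), so measurability at fixed times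
     suffices. *)
  rewrite (_ : _ @^-1` B = \bigcup_j
    ((fun z : R * T => Num.max z.1 0 * n.+1%:R) @^-1` `[j%:R, j.+1%:R[
     `&` (fun z : R * T => f (j.+1%:R / n.+1%:R) z.2) @^-1` B)).
    apply: bigcupT_measurable => j; apply: measurableI; rewrite -[X in measurable X]setTI.
      apply: measurable_funM => //.
      by apply: measurable_maxr => //; exact: measurable_fst.
    have m1 : measurable_fun setT (f (j.+1%:R / n.+1%:R)) by apply: mf; rewrite divr_ge0.
    by apply: (measurableT_comp m1 measurable_snd).
  have u0 (u : R) : 0 <= Num.max u 0 * n.+1%:R by rewrite mulr_ge0// le_max lexx orbT.
  apply/seteqP; split => [[u w]/= Bf|[u w] [j _ []]/=].
    exists (Num.truncn (Num.max u 0 * n.+1%:R)) => //; split => //=.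
    by rewrite in_itv/= truncn_itv.
  by rewrite in_itv/= => /truncn_def <-.
move=> [u w] _ /=.
have u0 : 0 <= Num.max u 0 by rewrite le_max lexx orbT.
have /cvg_at_rightP := @f_right w _ u0; apply; split.
  by move=> n; have /andP[] := q_gt n u.
apply: (@squeeze_cvgr _ _ _ _ (fun=> Num.max u 0) (fun n => Num.max u 0 + n.+1%:R^-1)).
- by apply: nearW => n; have /andP[/ltW -> ->] := q_gt n u.
- exact: cvg_cst.
- by rewrite -[X in _ --> X]addr0; apply: cvgD; [exact: cvg_cst|exact: cvg_harmonic].
Qed.

Lemma measurable_path w (t : R) : measurable_fun `[0, t] (f ^~ w).
Proof.
have := measurable_fun_pair1 w measurable_path_joint.
move=> /(measurable_funS measurableT (@subsetT _ `[0, t])).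
apply: eq_measurable_fun => u; rewrite inE/= in_itv/= => /andP[u0 _].
by rewrite max_l.
Qed.

Lemma integrable_path w (t : R) : mu.-integrable `[0, t] (EFin \o f ^~ w).
Proof.
have [M hM] := path_bounded w t.
apply: (@le_integrable _ _ _ _ _ _ _ (EFin \o (fun=> M))) => //.
- by apply/measurable_EFinP; exact: measurable_path.
- move=> u /=; rewrite in_itv/= => ut; rewrite lee_fin.
  by apply: le_trans (hM u ut) _; exact: ler_norm.
- apply/integrableP; split; first by apply/measurable_EFinP.
  rewrite integral_cst//= lebesgue_measure_itv/=; case: ifP => _.
    by rewrite -EFinB -EFinM ltry.
  by rewrite mule0 ltry.
Qed.

Lemma path_integral_ge0 t w : 0 <= path_integral t w.
Proof.
by apply: Rintegral_ge0 => u /=; rewrite in_itv/= => /andP[u0 _]; exact: f_ge0.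
Qed.

Lemma measurable_path_integral t : measurable_fun setT (path_integral t).
Proof.
pose g (z : measurableTypeR R * T) : \bar R := (f (Num.max z.1 0) z.2 * \1_(`[0, t]%classic) z.1)%:E.
have mg : measurable_fun setT g.
  apply/measurable_EFinP; apply: measurable_funM; first exact: measurable_path_joint.
  by apply: measurableT_comp => //; exact: measurable_indic.
have g0 z : (0 <= g z)%E.
  by rewrite lee_fin mulr_ge0// ?f_ge0 ?le_max ?lexx ?orbT// indicE.
have := measurable_fun_fubini_tonelli_G (m1 := mu) g mg g0.
rewrite (_ : path_integral t = fine \o fubini_G mu g).
  by exact: measurableT_comp.
apply/funext => w; rewrite /path_integral /Rintegral /= /fubini_G; congr fine.
rewrite [LHS]integral_mkcond; apply: eq_integral => u _.
rewrite patchE /g /= indicE; case: ifPn => [|_]; last by rewrite mulr0.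
by rewrite inE/= in_itv/= => /andP[u0 _]; rewrite max_l// mulr1.
Qed.

Lemma path_integral0 w : path_integral 0 w = 0.
Proof. by rewrite /path_integral set_itv1 Rintegral_set1. Qed.

Lemma path_integralB w (s t : R) : 0 <= s -> s <= t ->
  path_integral t w - path_integral s w = \int[mu]_(u in `]s, t]) f u w.
Proof.
by move=> s0 st; apply: Rintegral_itvB; rewrite ?bnd_simp//; exact: integrable_path.
Qed.

Lemma le_path_integral w (s t : R) : 0 <= s -> s <= t ->
  path_integral s w <= path_integral t w.
Proof.
move=> s0 st; rewrite -subr_ge0 path_integralB//.
apply: Rintegral_ge0 => u /=; rewrite in_itv/= => /andP[su _].
by apply: f_ge0; exact: le_trans (ltW su).
Qed.

Lemma path_integral_right w (t y : R) : 0 <= t -> path_integral t w < y ->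
  exists2 s, t < s & path_integral s w < y.
Proof.
move=> t0 ty; have [M hM] := path_bounded w (t + 1).
have M0 : 0 <= M.
  by apply: le_trans (normr_ge0 (f t w)) _; apply: hM; rewrite t0 lerDl ler01.
(* As the rate is at most [M] up to t + 1, a step of at most [e] uses less than the gap up to y; the
   + 1 avoids a zero denominator. *)
pose e := (y - path_integral t w) / (2 * (M + 1)).
have e0 : 0 < e by rewrite divr_gt0 ?subr_gt0//; lra.
pose s := t + Num.min 1 e.
have ts : t < s by rewrite ltrDl lt_min ltr01.
have s1 : s <= t + 1 by rewrite lerD2l ge_min lexx.
exists s => //.
have it : mu.-integrable `]t, s] (EFin \o f ^~ w).
  by apply: integrableS (integrable_path w s) => //; apply: subset_itvr; rewrite bnd_simp.
have : path_integral s w - path_integral t w <= M * (s - t).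
  rewrite path_integralB ?(ltW ts)//.
  apply: (@le_trans _ _ (\int[mu]_(u in `]t, s]) (fun=> M) u)).
    apply: le_Rintegral => //.
      apply/integrableP; split; first by apply/measurable_EFinP.
      by rewrite integral_cst//= lebesgue_measure_itv/= lte_fin ts -EFinB -EFinM ltry.
    move=> u /=; rewrite in_itv/= => /andP[tu us].
    apply: le_trans (ler_norm _) (hM u _).
    by rewrite (le_trans t0 (ltW tu)) (le_trans us s1).
  by rewrite Rintegral_cst//= lebesgue_measure_itv/= lte_fin ts.
have se : M * (s - t) < y - path_integral t w.
  have : s - t <= e by rewrite /s [t + _]addrC addrK ge_min lexx orbT.
  have eM : e * (2 * (M + 1)) = y - path_integral t w.
    by rewrite /e divfK//; lra.
  by move=> se; nra.
by lra.
Qed.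

Lemma path_integral_IVT w (t y : R) : 0 <= t -> 0 <= y -> y <= path_integral t w ->
  exists2 s, 0 <= s <= t & path_integral s w = y.
Proof.
move=> t0 y0 yt.
have [|||c] := @IVT R (path_integral ^~ w) 0 t y => //.
- exact: parameterized_integral_continuous (integrable_path w t).
- by rewrite path_integral0 min_l ?path_integral_ge0// max_r ?path_integral_ge0// y0.
by rewrite in_itv/= => ct e; exists c.
Qed.

(** Makes {t < tau} visibly measurable. If 0 <= E <= Lambda_t, the intermediate value theorem gives
    a hit by time t. If Lambda_t < E, the integral stays below E a little beyond t, so the infimum
    exceeds t strictly. A negative E is never hit, and the infimum of the empty set is +oo. *)
Lemma lt_hitting_time (E : T -> R) (t : R) w : 0 <= t ->
  (t%:E < ereal_inf [set u%:E | u in [set u : R | (0 <= u)%R /\ path_integral u w = E w]])%E =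
  ((E w < 0) || (path_integral t w < E w)).
Proof.
move=> t0; apply/idP/idP.
  move=> tt; apply: contraLR tt; rewrite negb_or -!leNgt => /andP[E0 Et].
  have [s /andP[s0 st] e] := path_integral_IVT t0 E0 Et.
  apply: (@le_trans _ _ s%:E); last by rewrite lee_fin.
  by apply: ereal_inf_lbound; exists s.
move=> /orP[E0|tE].
  rewrite (_ : [set _ | _ in _] = set0) ?ereal_inf0 ?ltry//.
  apply/seteqP; split => [z [u [u0 ue] _]|z []].
  by move: E0; rewrite -ue ltNge path_integral_ge0.
have [s ts sE] := path_integral_right t0 tE.
apply: (@lt_le_trans _ _ s%:E); first by rewrite lte_fin.
apply: le_ereal_inf_tmp => _ [u [u0 ue] <-]; rewrite lee_fin leNgt.
apply/negP => us; have := le_path_integral w u0 (ltW us).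
by rewrite ue leNgt sE.
Qed.

End PathIntegral.

(** * The affine stock model *)

Section KernelFourier.
Context {R : realType} {d : measure_display} {T : measurableType d}.
Context (P : probability T R) (rho Y : T -> R).
Hypotheses (mrho : measurable_fun setT rho) (mY : measurable_fun setT Y).
Hypothesis rho_ge0 : forall w, 0 <= rho w.

Lemma integrable_weight_bounded (r : R) (g : T -> R) :
  (\int[P]_w (weight rho Y r w)%:E < +oo)%E ->
  measurable_fun setT g -> (forall w, `|g w| <= 1) ->
  P.-integrable setT (EFin \o (fun w => weight rho Y r w * g w)).
Proof.
move=> fr mg g1.
apply: le_integrable (integrable_weight mrho mY rho_ge0 fr) => //.
  apply/measurable_EFinP; apply: measurable_funM => //.
  exact: measurable_weight.
move=> w _ /=; rewrite lee_fin normrM ler_piMr//; exact: g1.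
Qed.

(** The addition formulas separate k from Y; the two integrals left are the real and imaginary parts
    of h(r + iy). *)
Lemma integral_weight_kernel (r p k y : R) :
  (\int[P]_w (weight rho Y r w)%:E < +oo)%E ->
  \int[P]_w (weight rho Y r w * kernel p y (Y w - k)) =
  (p * cos (y * k) - y * sin (y * k)) / (p ^+ 2 + y ^+ 2) *
    \int[P]_w (weight rho Y r w * cos (y * Y w)) +
  (p * sin (y * k) + y * cos (y * k)) / (p ^+ 2 + y ^+ 2) *
    \int[P]_w (weight rho Y r w * sin (y * Y w)).
Proof.
move=> fr.
have myY : measurable_fun setT (fun w => y * Y w) by exact: measurable_funM.
have ic : P.-integrable setT (EFin \o (fun w => weight rho Y r w * cos (y * Y w))).
  apply: integrable_weight_bounded => // [|w]; last exact: cos_max.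
  by apply: measurableT_comp myY; apply: continuous_measurable_fun; exact: continuous_cos.
have isi : P.-integrable setT (EFin \o (fun w => weight rho Y r w * sin (y * Y w))).
  apply: integrable_weight_bounded => // [|w]; last exact: sin_max.
  by apply: measurableT_comp myY; apply: continuous_measurable_fun; exact: continuous_sin.
have iZ (c : R) g : P.-integrable setT (EFin \o g) ->
    P.-integrable setT (EFin \o (fun w => c * g w)).
  by move=> ig; rewrite (_ : _ \o _ = (fun w => c%:E * (g w)%:E)%E)//; exact: integrableZl.
rewrite -!RintegralZl// -RintegralD//; [|exact: iZ|exact: iZ].
apply: eq_Rintegral => w _; rewrite /kernel mulrBr cosB sinB; ring.
Qed.

End KernelFourier.

Lemma Re_digital_kernel (R : realType) (A B p k y : R) :
  complex.Re (cexp (0 -i* (y * k)) * ((A +i* B) / (p +i* y))) =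
  (p * cos (y * k) - y * sin (y * k)) / (p ^+ 2 + y ^+ 2) * A +
  (p * sin (y * k) + y * cos (y * k)) / (p ^+ 2 + y ^+ 2) * B.
Proof. by rewrite /cexp /= expR0 cosN sinN; ring. Qed.

Lemma Re_call_kernel (R : realType) (A B p k y : R) : 0 < y ->
  complex.Re (cexp (0 -i* (y * k)) *
    ((A +i* B) / ((p ^+ 2 + p - y ^+ 2) +i* (y * (2 * p + 1))))) =
  (p * cos (y * k) - y * sin (y * k)) / (p ^+ 2 + y ^+ 2) * A +
  (p * sin (y * k) + y * cos (y * k)) / (p ^+ 2 + y ^+ 2) * B -
  (((p + 1) * cos (y * k) - y * sin (y * k)) / ((p + 1) ^+ 2 + y ^+ 2) * A +
   ((p + 1) * sin (y * k) + y * cos (y * k)) / ((p + 1) ^+ 2 + y ^+ 2) * B).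
Proof.
move=> y0; rewrite /cexp /= expR0 cosN sinN.
have h1 := den_gt0 p y0; have h2 := den_gt0 (p + 1) y0.
(* The denominator is (p + iy) (p + 1 + iy), and squared moduli multiply. *)
have -> : (p ^+ 2 + p - y ^+ 2) ^+ 2 + (y * (2 * p + 1)) ^+ 2 =
    (p ^+ 2 + y ^+ 2) * ((p + 1) ^+ 2 + y ^+ 2) by ring.
by field; rewrite !gt_eqF.
Qed.

(** * Measurability and path regularity of affine rates *)

Section PathMeasurability.
Context {R : realType} {n m : nat} {hmn : (m <= n)%N}.
Context {d : measure_display} {T : measurableType d}.
Context {P : 'rV[R]_n -> probability T R} {X : R -> T -> 'rV[R]_n}.
Context {A : affine_param R n m} (hX : affine_process hmn P X A).

Lemma measurable_coord (i : 'I_n) :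
  @measurable_fun _ _ (borel_rV R n) R setT (fun x : 'rV[R]_n => x 0 i).
Proof.
apply: (measurability _ (RGenOInfty.measurableE R)) => _ [_ [a ->] <-].
rewrite setTI; apply: sub_sigma_algebra.
by apply: open_comp => [x _|]; [exact: coord_continuous|exact: interval_open].
Qed.

Lemma measurable_X_coord (t : R) (i : 'I_n) : 0 <= t ->
  measurable_fun setT (fun w => X t w 0 i).
Proof.
move=> t0; case: (aff_markov hX) => mX _ _ _ _.
exact: (measurableT_comp (measurable_coord i) (mX t t0)).
Qed.

(** The common form of the integrands of [R_] and [Lambda_]. *)
Definition rate (c : R) (gamma : 'rV[R]_m) (u : R) (w : T) : R :=
  c + dot gamma (subvecI hmn (X u w)).

Context (c : R) (gamma : 'rV[R]_m).

Lemma measurable_rate u : 0 <= u -> measurable_fun setT (rate c gamma u).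
Proof.
move=> u0; apply: measurable_funD => //; apply: measurable_sum => i.
apply: measurable_funM => //.
rewrite (_ : (fun _ => _) = (fun w => X u w 0 (widen_ord hmn i))).
  exact: measurable_X_coord.
by apply/funext => w; rewrite mxE.
Qed.

Lemma cvg_rate w (F : set_system R) (x : 'rV[R]_n) : Filter F ->
  X s w @[s --> F] --> x ->
  rate c gamma s w @[s --> F] --> c + dot gamma (subvecI hmn x).
Proof.
move=> FF cX; apply: cvgD; first exact: cvg_cst.
rewrite /dot; apply: cvg_big => [|i _]; first exact: add_continuous.
apply: cvgMl_tmp; rewrite mxE.
under eq_fun do rewrite mxE.
exact: (cvg_comp _ _ cX (@coord_continuous _ _ _ 0 (widen_ord hmn i) x)).
Qed.

Lemma rate_right w (u : R) : 0 <= u -> rate c gamma s w @[s --> u^'+] --> rate c gamma u w.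
Proof.
by move=> u0; apply: cvg_rate; have [] := aff_rcll hX w u0.
Qed.

Lemma rate_left w (u : R) : 0 < u ->
  exists l : R, rate c gamma s w @[s --> u^'-] --> l.
Proof.
move=> u0; have [_ /(_ u0)[x cx]] := aff_rcll hX w (ltW u0).
by exists (c + dot gamma (subvecI hmn x)); exact: cvg_rate.
Qed.

Lemma rate_ge0 w (u : R) : 0 <= c -> (forall i, 0 <= gamma 0 i) -> 0 <= u ->
  0 <= rate c gamma u w.
Proof.
move=> c0 g0 u0; case: (aff_markov hX) => _ /(_ u w u0) DX _ _ _.
apply: addr_ge0 => //; apply: sumr_ge0 => i _; apply: mulr_ge0 => //.
by rewrite mxE; apply: DX; rewrite /= ltn_ord.
Qed.

End PathMeasurability.

Unset Implicit Arguments.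

(** The digital prices carry a no-atom condition because sgn 0 = 0: the inversion integral counts
    half of a mass at log S = k, the strict inequality none of it. The call payoff is continuous
    across the strike. *)
Theorem theorem3p8 (R : realType) (n m : nat) (hn : (1 <= n)%N)
    (hmn : (m <= n)%N) (d : measure_display) (T : measurableType d)
    (P : 'rV[R]_n -> probability T R) (X : R -> T -> 'rV[R]_n)
    (A : affine_param R n m) (hX : affine_process hmn P X A)
    (E : T -> R) (hE : standard_exponential_indep m P X E)
    (sp : stock_param R n m)
    (t : R) (x : 'rV[R]_n) (ht : 0 <= t) (hx : state_space R n m x)
    (p q : R) (hp : U_ hmn P X E sp t x (p + 1)%:C)
    (hq : U_ hmn P X E sp t x q%:C) (k : R) :
  [/\ P x [set w | logS hmn X E sp t w = k%:E] = 0%E ->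
        inversion_formula (price_a hmn P X E sp t x k)
          (R_a hmn P X E sp t x p) p k (g_a hmn P X E sp t x p),
      P x [set w | logS hmn X E sp t w = k%:E] = 0%E ->
        inversion_formula (price_b hmn P X E sp t x k)
          (R_b hmn P X E sp t x q) q k (g_b hmn P X E sp t x q)
    & inversion_formula (price_c hmn P X E sp t x k)
        (R_c hmn P X E sp t x k p) p k (g_c hmn P X E sp t x p)].
Proof.
pose Y := S_exponent hmn X sp t.
(* On survival S = e^Y, and [rho] vanishes otherwise, so all prices and moments become expectations
   in [rho] and [Y]. *)
pose rho w := expR (- R_ hmn X sp t w) * alive hmn X E sp t w.
have mf c gamma := @measurable_rate _ _ _ _ _ _ _ _ _ hX c gamma.
have fr c gamma := @rate_right _ _ _ _ _ _ _ _ _ hX c gamma.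
have fl c gamma := @rate_left _ _ _ _ _ _ _ _ _ hX c gamma.
have fd0 w u := @rate_ge0 _ _ _ _ _ _ _ _ _ hX _ _ w u (sp_d_ge0 sp) (sp_delta_ge0 sp).
have fc0 w u := @rate_ge0 _ _ _ _ _ _ _ _ _ hX _ _ w u (sp_c_ge0 sp) (sp_gamma_ge0 sp).
have mR : measurable_fun setT (R_ hmn X sp t).
  exact: (measurable_path_integral (mf _ _) (fr _ _) fd0 t).
have mL : measurable_fun setT (Lambda_ hmn X sp t).
  exact: (measurable_path_integral (mf _ _) (fr _ _) fc0 t).
have ms : measurable_fun setT (s_ X sp t).
  apply: measurable_funD => //; apply: measurable_sum => i.
  by apply: measurable_funM => //; exact: (measurable_X_coord hX).
have mY : measurable_fun setT Y by do 2 apply: measurable_funD => //.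
have mE : measurable_fun setT E by case: hE.
have malive : measurable_fun setT (alive hmn X E sp t).
  rewrite (_ : alive _ _ _ _ _ = (fun w => if E w < 0 then 1 else
      if Lambda_ hmn X sp t w < E w then 1 else 0)).
    apply: measurable_fun_ifT => //; first exact: measurable_fun_ltr.
    by apply: measurable_fun_ifT => //; exact: measurable_fun_ltr.
  apply/funext => w; rewrite /alive /tau.
  rewrite (lt_hitting_time (mf _ _) (fr _ _) (fl _ _) fc0 E w ht).
  by case: ifP => //= _; case: ifP.
have R0 w : 0 <= R_ hmn X sp t w by exact: path_integral_ge0 fd0 t w.
have a01 w : alive hmn X E sp t w = 0 \/ alive hmn X E sp t w = 1.
  by rewrite /alive; case: (_ < _)%E; [right|left].
have mrho : measurable_fun setT rho.
  by apply: measurable_funM => //; apply: measurableT_comp => //; exact: measurableT_comp.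
have rho_ge0 w : 0 <= rho w.
  by rewrite mulr_ge0 ?expR_ge0//; case: (a01 w) => ->.
have rho_le1 w : rho w <= 1.
  have e1 : expR (- R_ hmn X sp t w) <= 1 by rewrite expR_le1 oppr_le0.
  by rewrite /rho; case: (a01 w) => ->; rewrite ?mulr0 ?mulr1.
have momE r : moment hmn P X E sp t x r = (\int[P x]_w (weight rho Y r w)%:E)%E.
  by apply: eq_integral => w _; rewrite /weight /rho; congr EFin; rewrite mulrAC.
have hE' a b : h_ hmn P X E sp t x (a +i* b) =
    (\int[P x]_w (weight rho Y a w * cos (b * Y w))) +i*
    (\int[P x]_w (weight rho Y a w * sin (b * Y w))).
  rewrite /h_ /cexpectation; congr (_ +i* _); apply: eq_Rintegral => w _.
    rewrite /cexp /= /weight /rho -/(Y w) !(mulr0, mul0r, subr0, add0r, addr0).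
    by ring.
  rewrite /cexp /= /weight /rho -/(Y w) !(mulr0, mul0r, subr0, add0r, addr0).
  by ring.
have fp : (\int[P x]_w (weight rho Y (p + 1) w)%:E < +oo)%E by rewrite -momE.
have fq : (\int[P x]_w (weight rho Y q w)%:E < +oo)%E by rewrite -momE.
have logSE w : alive hmn X E sp t w = 1 -> logS hmn X E sp t w = (Y w)%:E.
  by move=> a1; rewrite /logS /S_ a1 mulr1 lne_EFin ?expR_gt0// expRK.
have logS0 w : alive hmn X E sp t w = 0 -> logS hmn X E sp t w = -oo%E.
  by move=> a0; rewrite /logS /S_ a0 mulr0 le0_lneNy.
(* Defaulted paths have log S = -oo, so log S = k means survival with Y = k, and survival is the
   same as [rho] being nonzero. *)
have null : P x [set w | logS hmn X E sp t w = k%:E] = 0%E ->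
    P x [set w | rho w != 0 /\ Y w = k] = 0%E.
  move=> <-; congr (P x _); apply/seteqP; split => w /=; rewrite /rho;
    case: (a01 w) => aw; rewrite aw ?mulr0 ?eqxx ?mulr1.
  - by case.
  - by rewrite logSE// => -[_ ->].
  - by rewrite logS0.
  - by rewrite logSE// => -[->]; rewrite gt_eqF ?expR_gt0.
split.
- move=> /null nk; rewrite /R_a momE.
  (* The transform is taken at order p + 1 and the residue at order 1; for the second price the
     orders are q and 0. *)
  have e1 : p + 1 - p = 1 by ring.
  have := digital_inversion mrho mY rho_ge0 fp nk (p := p).
  rewrite e1; apply => [w|y y0].
    rewrite /weight /rho /S_ mul1r; case: (a01 w) => aw; rewrite aw.
      by rewrite !(mulr0, mul0r).
    by rewrite logSE// lte_fin !mulr1.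
  by rewrite /g_a hE' Re_digital_kernel (integral_weight_kernel mrho mY rho_ge0 _ _ _ fp).
- move=> /null nk; rewrite /R_b momE.
  have := digital_inversion mrho mY rho_ge0 fq nk (p := q).
  rewrite subrr; apply => [w|y y0].
    rewrite /weight /rho mul0r expR0 mulr1; case: (a01 w) => aw; rewrite aw.
      by rewrite logS0//= !(mulr0, mul0r).
    by rewrite logSE// lte_fin !mulr1.
  by rewrite /g_b hE' Re_digital_kernel (integral_weight_kernel mrho mY rho_ge0 _ _ _ fq).
- rewrite /R_c !momE; apply: (call_inversion mrho mY rho_ge0 rho_le1 fp) => [w|y y0].
    rewrite /rho /S_; case: (a01 w) => aw; rewrite aw ?mulr1//.
    by rewrite !mulr0 mul0r sub0r max_r ?mulr0// oppr_le0 expR_ge0.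
  rewrite /g_c hE' Re_call_kernel//.
  by rewrite !(integral_weight_kernel mrho mY rho_ge0 _ _ _ fp).
Qed.
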